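(* Let $d$ be an integer congruent to $0$ or $1$ modulo $4$. (I) If $m$ is a nonzero integer coprime to $d$, then $C(d,m)=K(d,m)$. Moreover $C(d,1)=C(d,-1)=1$. (II) Let $p$ be a prime factor of $d$ (any prime is allowed if $d=0$), and write $B(d,n):=C(d,p^n)$ for integers $n\ge 0$; likewise write $B(0,n):=C(0,p^n)$ for the same prime $p$. Then $B(d,0)=B(d,1)=1$, and for $n\ge 2$ the following hold. (a) Putting $k:=\lfloor n/2\rfloor+1$, we have $B(0,n)=(p^k-1)/(p-1)$. (b) Suppose $p$ is odd and $d\neq 0$; write $d=p^\delta D$ with $\delta>0$ and $D$ prime to $p$. If $n\le\delta$, then $B(d,n)=B(0,n)$. If $n>\delta$, put $k:=\lceil (n-\delta)/2\rceil$; then $$B(d,n)=\begin{cases}B(0,n-2k)+2k\,p^{\delta/2}&\text{if } d \text{ is the square of a } p\text{-adic integer},\\ B(0,n-2k)&\text{otherwise.}\end{cases}$$ (c) Suppose $p=2$, and let $\delta$ be a positive integer. (c1) If $d=2^{2\delta+1}D$ with $D$ odd, then $B(d,n)=B(0,n)$ if $n\le 2\delta-1$, and $B(d,n)=2^\delta-1$ if $n\ge 2\delta$. (c2) If $d=2^{2\delta}D$ with $D\equiv 3 \bmod 4$, then $B(d,n)=B(0,n)$ if $n\le 2\delta-2$, and $B(d,n)=2^\delta-1$ if $n\ge 2\delta-2$. (c3) If $d=2^{2\delta}D$ with $D\equiv 5\bmod 8$, then $B(d,n)=B(0,n)$ if $n\le 2\delta-2$; if $n\ge 2\delta-1$, then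 $B(d,n)=2^\delta-1$ when $n$ is odd and $B(d,n)=2^{\delta+1}-1$ when $n$ is even. (c4) If $d=2^{2\delta}D$ with $D\equiv 1\bmod 8$ (i.e. $d$ is the square of a $2$-adic integer), then $B(d,n)=B(0,n)$ if $n\le 2\delta-2$, and for every integer $k\ge 0$ $$B(d,2\delta-1+2k)=2^\delta(2k+1)-1,\qquad B(d,2\delta+2k)=2^{\delta+1}(k+1)-1.$$
   Context: Definition of $C(d,m)$. For an integer $d\equiv 0$ or $1\bmod 4$ and a nonzero integer $m$, let $F$ be the (nonempty) set of all binary quadratic forms $f=[a,b,c]:=aX^2+bXY+cY^2$ with integers $a,b,c$ satisfying $b^2-4ac=d$ (no primitivity or definiteness condition is imposed); each $f$ is also viewed as a function $\mathbb{Z}^2\to\mathbb{Z}$. The group $G:=\mathrm{SL}(2,\mathbb{Z})$ acts naturally on $F$ by linear substitution, $(fg)(z)=f(gz)$. Let $S\subset F$ be a system of representatives for the $G$-orbits in $F$. For $f\in S$, let $\mathrm{SO}(f)$ be the stabilizer of $f$ in $G$; it acts on the set $f^{-1}(m)=\{z\in\mathbb{Z}^2: f(z)=m\}$. Define $$C(d,m):=\sum_{f\in S}|\mathrm{SO}(f)\backslash f^{-1}(m)|,$$ which does not depend on the choice of $S$. Definition of $K(d,m)$. For $d\equiv 0$ or $1\bmod 4$, let $\chi$ be the map from the positive integers to the integers characterized by: $\chi(1)=1$; $\chi(p)=0$ if $p$ is a prime dividing $d$; $\chi(p)$ is the Legendre symbol $\left(\frac{d}{p}\right)$ if $p$ is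 an odd prime not dividing $d$; $\chi(2)=1$ if $d\equiv 1\bmod 8$ and $\chi(2)=-1$ if $d\equiv 5\bmod 8$; and $\chi(mn)=\chi(m)\chi(n)$ for all $m,n$. Put $\left(\frac{d}{n}\right):=\chi(n)$ for $n>0$ (Kronecker symbol), and for every nonzero integer $m$ $$K(d,m):=\sum_{0<\mu\mid m}\left(\frac{d}{\mu}\right).$$ *)

(* Defs.v *)
From HB Require Import structures.
From mathcomp Require Import all_boot all_order all_algebra.
From mathcomp Require Import all_classical all_reals all_analysis.
From mathcomp Require Import ring.

Set Implicit Arguments.
Unset Strict Implicit.
Unset Printing Implicit Defensive.
Import Order.TTheory GRing.Theory Num.Theory.

Local Open Scope classical_set_scope.
Local Open Scope ring_scope.

Definition is_discriminant (d : int) : Prop :=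
  (d = 0 %[mod 4])%Z \/ (d = 1 %[mod 4])%Z.

(* The triple (a, b, c) stands for a X^2 + b X Y + c Y^2. *)
Definition bqf := (int * int * int)%type.

Definition bqf_disc (f : bqf) : int :=
  let: (a, b, c) := f in b ^+ 2 - 4 * a * c.

Definition bqf_eval (f : bqf) (z : 'cV[int]_2) : int :=
  let: (a, b, c) := f in
  a * z 0 0 ^+ 2 + b * z 0 0 * z 1 0 + c * z 1 0 ^+ 2.

Definition forms_of_disc (d : int) : set bqf := [set f | bqf_disc f = d].

Definition SL2Z : set 'M[int]_2 := [set g | \det g = 1].

(* The coefficients of f (g z); see bqf_eval_act. *)
Definition bqf_act (f : bqf) (g : 'M[int]_2) : bqf :=
  let: (a, b, c) := f in
  (a * g 0 0 ^+ 2 + b * g 0 0 * g 1 0 + c * g 1 0 ^+ 2,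
   2 * a * g 0 0 * g 0 1 + b * (g 0 0 * g 1 1 + g 0 1 * g 1 0)
     + 2 * c * g 1 0 * g 1 1,
   a * g 0 1 ^+ 2 + b * g 0 1 * g 1 1 + c * g 1 1 ^+ 2).

Lemma bqf_eval_act (f : bqf) (g : 'M[int]_2) (z : 'cV[int]_2) :
  bqf_eval (bqf_act f g) z = bqf_eval f (g *m z).
Proof.
case: f => [[a b] c]; rewrite /bqf_eval /bqf_act !mxE !big_ord_recl !big_ord0 !addr0.
have -> : lift ord0 (ord0 : 'I_1) = 1 :> 'I_2 by apply/val_inj.
by rewrite -[ord0]/(0 : 'I_2); ring.
Qed.

Definition is_representatives (d : int) (S : set bqf) : Prop :=
  S `<=` forms_of_disc d /\
  forall f, forms_of_disc d f ->
    exists! h, S h /\ exists2 g, SL2Z g & h = bqf_act f g.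

Definition SO (f : bqf) : set 'M[int]_2 := [set g | SL2Z g /\ bqf_act f g = f].

Definition SO_orbit (f : bqf) (z : 'cV[int]_2) : set 'cV[int]_2 :=
  [set g *m z | g in SO f].

Definition SO_orbits (f : bqf) (m : int) : set (set 'cV[int]_2) :=
  [set SO_orbit f z | z in [set z | bqf_eval f z = m]].

(* S e is the chosen system of representatives in discriminant e.  The value
   lies in the extended reals: it is +oo if some orbit set is infinite or if
   infinitely many f contribute, so an equation with a finite right-hand side
   includes the finiteness of the sum. *)
Definition C (R : realType) (S : int -> set bqf) (d m : int) : \bar R :=
  \esum_(f in S d) counting (SO_orbits f m).

Definition legendre (d : int) (p : nat) : int :=
  if (p%:Z %| d)%Z then 0
  else if [exists x : 'I_p, (p%:Z %| x%:Z ^+ 2 - d)%Z] then 1 else -1.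

(* The value at 2 is meant for d = 0 or 1 mod 4 only. *)
Definition kronecker_prime (d : int) (p : nat) : int :=
  if (p%:Z %| d)%Z then 0
  else if p == 2%N then (if (d == 1 %[mod 8])%Z then 1 else -1)
  else legendre d p.

Definition kronecker (d : int) (n : nat) : int :=
  \prod_(p < n.+1 | prime p) kronecker_prime d p ^+ logn p n.

Lemma kronecker_wide (d : int) (n N : nat) : (0 < n)%N -> (n <= N)%N ->
  kronecker d n = \prod_(p < N.+1 | prime p) kronecker_prime d p ^+ logn p n.
Proof.
move=> n0 nN; rewrite /kronecker.
rewrite (big_ord_widen_cond N.+1 prime
  (fun p => kronecker_prime d p ^+ logn p n)) //.
rewrite [RHS](bigID (fun p : 'I_N.+1 => (p < n.+1)%N)) /=.
rewrite [X in _ = _ * X]big1 ?mulr1 // => p /andP[pp]; rewrite -leqNgt => np.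
by rewrite lognE pp n0 /=; case: ifP => // /(dvdn_leq n0); rewrite leqNgt np.
Qed.

Lemma kronecker1 (d : int) : kronecker d 1 = 1.
Proof. by rewrite /kronecker big1 // => p _; rewrite logn1. Qed.

Lemma kroneckerM (d : int) (m n : nat) : (0 < m)%N -> (0 < n)%N ->
  kronecker d (m * n) = kronecker d m * kronecker d n.
Proof.
move=> m0 n0; rewrite (@kronecker_wide d m (m * n)) ?leq_pmulr //.
rewrite (@kronecker_wide d n (m * n)) ?leq_pmull // -big_split /=.
by apply: eq_bigr => p _; rewrite lognM // exprD.
Qed.

Lemma kronecker_at_prime (d : int) (p : nat) : prime p ->
  kronecker d p = kronecker_prime d p.
Proof.
move=> pp; rewrite /kronecker (bigD1 (@ord_max p)) //= big1 => [|i].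
  by rewrite mulr1 logn_prime // eqxx expr1.
case/andP=> ip; rewrite -val_eqE /= => ni.
by rewrite logn_prime // (negPf ni).
Qed.

Definition K (d m : int) : int := \sum_(mu <- divisors `|m|%N) kronecker d mu.

(* p-adic integers as the inverse limit of the rings Z / p^k, each class being
   given by its least non-negative residue. *)
Record padic_int (p : nat) := PadicInt {
  padic_res : nat -> int;
  padic_coh : forall k, (padic_res k.+1 %% p%:Z ^+ k)%Z = padic_res k }.

Lemma padic_of_int_coh (p : nat) (d : int) (k : nat) :
  ((d %% p%:Z ^+ k.+1)%Z %% p%:Z ^+ k)%Z = (d %% p%:Z ^+ k)%Z.
Proof.
by rewrite [in RHS](divz_eq d (p%:Z ^+ k.+1)) [in RHS]exprS mulrA modzMDl exprS.
Qed.

Definition padic_of_int (p : nat) (d : int) : padic_int p :=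
  PadicInt (padic_of_int_coh p d).

Lemma padic_mul_coh (p : nat) (x y : padic_int p) (k : nat) :
  ((padic_res x k.+1 * padic_res y k.+1 %% p%:Z ^+ k.+1)%Z %% p%:Z ^+ k)%Z =
  (padic_res x k * padic_res y k %% p%:Z ^+ k)%Z.
Proof. by rewrite padic_of_int_coh -modzMml -modzMmr !padic_coh. Qed.

Definition padic_mul (p : nat) (x y : padic_int p) : padic_int p :=
  PadicInt (padic_mul_coh x y).

Definition is_padic_square (p : nat) (d : int) : Prop :=
  exists x : padic_int p, padic_of_int p d = padic_mul x x.

(* Main.v *)
Require Import Defs.
From HB Require Import structures.
From mathcomp Require Import all_boot all_order all_algebra.
From mathcomp Require Import all_classical all_reals all_analysis.
From mathcomp Require Import ring zify.

Set Implicit Arguments.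
Unset Strict Implicit.
Unset Printing Implicit Defensive.
Import Order.TTheory GRing.Theory Num.Theory.

Local Open Scope classical_set_scope.
Local Open Scope ring_scope.

(** Both parts rest on one formula.  [C d m] counts the SL(2,Z)-classes of pairs
(f, z) with f of discriminant d and f(z) = m.  As m is nonzero, so is z, and a
class contains a pair with z = (t, 0), where t > 0 is the content of z; then
f = [a, b, c] with a = m / t^2.  What remains of SL(2,Z) is the group of
translations, which moves b modulo 2a.  Writing d = u^2 - 4v, the condition on
b = 2x + u is that a divides x^2 + ux + v.  Hence
  C(d, m) = sum over t with t^2 | m of N(m / t^2),
where N(k) is the number of roots of x^2 + ux + v modulo k
([class_bijection], [class_count]).

The function N is multiplicative by the Chinese remainder theorem
([nrootsM]), hence so is the sum above ([nclassesM]), and only the values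
N(p^j) matter.

When p does not divide d, all roots modulo p are simple, so that by Hensel
N(p^j) = N(p) = 1 + (d/p) for all j > 0 ([nroots_hensel], [nroots_kronecker]).
Then the sums over t and over the divisors of m coincide at prime powers
([nclasses_kronecker]), which is part (I).

When p divides d, completing the square turns N(p^j) into the number of
solutions of x^2 = D modulo p^j, with D = d for p odd and D = d/4 for p = 2.
A solution modulo p^(j+2) for p^2 D is p times a class modulo p^(j+1) that solves
the congruence for D modulo p^j.  So the counts for p^2 D are p times those for D
([nroots_p2D]), and the
sums B(D, n) of the counts for D modulo p^n, p^(n-2), ... obey
  B(p^2 D, n+2) = 1 + p B(D, n)
([class_sum_p2D]).  As B(0, 0) = B(0, 1) = 1, this gives the geometric sums for
D = 0, and it reduces every other D to one that is prime to p or exactly divisible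
by p.  For a unit D the value is governed by the square class of D in
the p-adic integers: a residue symbol for p odd ([class_sum_odd_disc]), and D
modulo 8 for p = 2, where x odd is written 2y + 1 so that the problem becomes the
separable equation y^2 + y + v = 0 ([nroots_1mod4]).  The same Hensel lifting
gives the p-adic square roots ([padic_square_odd], [padic_square_two]). *)

(** * Roots of a monic quadratic polynomial modulo m *)

Definition quad (u v x : int) : int := x ^+ 2 + u * x + v.

Definition nroots (u v : int) (m : nat) : nat :=
  (\sum_(x < m) nat_of_bool (m%:Z %| quad u v x%:Z)%Z)%N.

Lemma dvdz_congr (m a b : int) : (m %| a - b)%Z -> (m %| a)%Z = (m %| b)%Z.
Proof. by move=> h; rewrite -[in LHS](subrK b a) rpredDl. Qed.

Lemma dvdz_quad_congr (u v m a b : int) : (m %| a - b)%Z ->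
  (m %| quad u v a)%Z = (m %| quad u v b)%Z.
Proof.
move=> h; apply: dvdz_congr.
have -> : quad u v a - quad u v b = (a - b) * (a + b + u).
  by rewrite /quad; ring.
by rewrite dvdz_mulr.
Qed.

Lemma dvdz_sub_modn (x m : nat) : (m%:Z %| x%:Z - (x %% m)%N%:Z)%Z.
Proof.
apply/dvdzP; exists (x %/ m)%N%:Z.
by rewrite {1}(divn_eq x m) PoszD PoszM addrK.
Qed.

Lemma dvdz_prime_mul (p : nat) (a b : int) : prime p ->
  (p%:Z %| a * b)%Z = (p%:Z %| a)%Z || (p%:Z %| b)%Z.
Proof. by move=> pp; rewrite !dvdzE abszM /= Euclid_dvdM. Qed.

(** Division with remainder of the index by [n]; the form with an equation for
[N] avoids rewriting inside the ordinal type. *)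
Lemma sum_ord_block (N m n : nat) (F : nat -> nat) : N = (m * n)%N ->
  (\sum_(x < N) F x = \sum_(y < n) \sum_(t < m) F (y + n * t))%N.
Proof.
move->; rewrite -(big_mkord xpredT F) big_nat_mul big_mkord exchange_big /=.
apply: eq_bigr => t _.
rewrite -{1}[(t * n)%N]add0n big_addn mulSn addnK big_mkord.
by apply: eq_bigr => y _; rewrite (mulnC t).
Qed.

Lemma sum_ord_chinese (m n : nat) (F : nat -> nat -> nat) : coprime m n ->
  (\sum_(x < m * n) F (x %% m) (x %% n) =
   \sum_(y < m) \sum_(z < n) F y z)%N.
Proof.
case: m n => [|m] [|n] cmn; rewrite ?muln0 ?big_ord0 //.
  by rewrite big1 // => y _; rewrite big_ord0.
pose h (x : 'I_(m.+1 * n.+1)) : 'I_m.+1 * 'I_n.+1 :=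
  (Ordinal (ltn_pmod x (ltn0Sn m)), Ordinal (ltn_pmod x (ltn0Sn n))).
have hinj : injective h.
  move=> x y [e1 e2]; apply/val_inj => /=.
  have := chinese_remainder cmn x y.
  by rewrite e1 e2 !eqxx /= => /eqP; rewrite !modn_small.
have hbij : bijective h by apply: inj_card_bij => //; rewrite card_prod !card_ord.
by rewrite pair_big /= [RHS](reindex h) //=; exact: onW_bij.
Qed.

Lemma nrootsM (u v : int) (m n : nat) : coprime m n ->
  nroots u v (m * n) = (nroots u v m * nroots u v n)%N.
Proof.
move=> cmn.
pose P (k y : nat) : nat := (k%:Z %| quad u v y%:Z)%Z.
transitivity (\sum_(x < m * n) P m (x %% m) * P n (x %% n))%N.
  apply: eq_bigr => x _; rewrite /P mulnb PoszM Gauss_dvdz //.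
  by congr (nat_of_bool (_ && _)); apply/dvdz_quad_congr/dvdz_sub_modn.
rewrite (sum_ord_chinese (fun y z => P m y * P n z)%N) // big_distrl /=.
by apply: eq_bigr => y _; rewrite big_distrr.
Qed.

Lemma ltn_modz (a : int) (p : nat) : (0 < p)%N -> (`|(a %% p%:Z)%Z| < p)%N.
Proof.
move=> p0; have p0z : p%:Z != 0 by lia.
by have := ltz_mod a p0z; have := modz_ge0 a p0z; lia.
Qed.

(** The map t -> a + b t permutes the residues modulo [m]. *)
Lemma reindex_affine (m : nat) (a b : int) (F : nat -> nat) : coprimez m b ->
  (\sum_(t < m) F `|((a + b * t%:Z)%R %% m%:Z)%Z| = \sum_(t < m) F t)%N.
Proof.
case: m => [|m] cmb; first by rewrite !big_ord0.
pose h (t : 'I_m.+1) : 'I_m.+1 := Ordinal (ltn_modz (a + b * t%:Z) (ltn0Sn m)).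
have hinj : injective h.
  move=> x y [e]; apply/val_inj => /=.
  have e' : ((a + b * x%:Z) = (a + b * y%:Z) %[mod m.+1%:Z])%Z.
    have h1 := @modz_ge0 (a + b * x%:Z) m.+1%:Z isT.
    have h2 := @modz_ge0 (a + b * y%:Z) m.+1%:Z isT.
    by rewrite -(gez0_abs h1) -(gez0_abs h2) e.
  move/eqP: e'; rewrite eqz_mod_dvd.
  have -> : a + b * x%:Z - (a + b * y%:Z) = b * (x%:Z - y%:Z) by ring.
  rewrite Gauss_dvdzr // -eqz_mod_dvd !modz_nat => /eqP [].
  by rewrite !modn_small.
by rewrite [RHS](reindex h) //; apply/onW_bij/injF_bij.
Qed.

Lemma abs_modz_eq0 (a : int) (m : nat) :
  (`|(a %% m%:Z)%Z| == 0)%N = (m%:Z %| a)%Z.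
Proof. by rewrite absz_eq0; apply/eqP/dvdz_mod0P. Qed.

Lemma count_linear_root (p : nat) (a b : int) : prime p -> ~~ (p%:Z %| b)%Z ->
  (\sum_(t < p) nat_of_bool (p%:Z %| (a + b * t%:Z)%R)%Z = 1)%N.
Proof.
move=> pp npb.
have cpb : coprimez p b.
  by rewrite /coprimez /gcdz eqz_nat /= -/(coprime _ _) prime_coprime.
rewrite (eq_bigr _ (fun t _ => congr1 nat_of_bool (esym (abs_modz_eq0 _ p)))).
rewrite (@reindex_affine p a b (fun s => nat_of_bool (s == 0%N)) cpb).
by case: p pp {npb cpb} => // p _; rewrite big_ord_recl /= big1.
Qed.

(** The square of the derivative 2x + u is congruent to the discriminant at a root,
so roots modulo a prime that does not divide the discriminant are simple. *)
Lemma quad_deriv_unit (u v m x : int) : ~~ (m %| u ^+ 2 - 4 * v)%Z ->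
  (m %| quad u v x)%Z -> ~~ (m %| 2 * x + u)%Z.
Proof.
move=> npd mq; apply: contra npd => h.
have -> : u ^+ 2 - 4 * v = (2 * x + u) * (2 * x + u) - 4 * quad u v x.
  by rewrite /quad; ring.
by rewrite rpredB // dvdz_mull.
Qed.

(** Over a root y modulo p^k, the condition on y + p^k t is a linear congruence
for t modulo p whose slope 2y + u is a unit: it has exactly one solution. *)
Lemma nroots_hensel (u v : int) (p k : nat) : prime p ->
  ~~ (p%:Z %| u ^+ 2 - 4 * v)%Z -> (0 < k)%N ->
  nroots u v (p ^ k.+1) = nroots u v (p ^ k).
Proof.
move=> pp npd k0; rewrite /nroots.
rewrite (sum_ord_block (fun x => nat_of_bool ((p ^ k.+1)%N%:Z %| quad u v x%:Z)%Z)
  (expnS p k)).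
apply: eq_bigr => y _.
have pk0 : (p ^ k)%N%:Z != 0 by rewrite eqz_nat expn_eq0 -leqn0 leqNgt prime_gt0.
have E t : quad u v (y + p ^ k * t)%N%:Z = quad u v y%:Z
    + (p ^ k)%N%:Z * ((2 * y%:Z + u) * t%:Z + (p ^ k)%N%:Z * t%:Z ^+ 2).
  by rewrite /quad PoszD PoszM; ring.
case: (boolP ((p ^ k)%N%:Z %| quad u v y%:Z)%Z) => [/dvdzP[r Er]|nq] /=; last first.
  apply: big1 => t _; apply/eqP; rewrite eqb0; apply: contra nq => h.
  have : ((p ^ k)%N%:Z %| quad u v (y + p ^ k * t)%N%:Z)%Z.
    by apply: dvdz_trans h; rewrite dvdzE /= dvdn_exp2l.
  by rewrite E rpredDr // dvdz_mulr.
have pq : (p%:Z %| quad u v y%:Z)%Z.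
  by rewrite Er dvdz_mull // dvdzE /= dvdn_exp.
have npb : ~~ (p%:Z %| 2 * y%:Z + u)%Z by exact: quad_deriv_unit npd pq.
rewrite -[RHS](count_linear_root r pp npb); apply: eq_bigr => t _.
congr nat_of_bool; rewrite E Er mulrC -mulrDr expnSr PoszM dvdz_mul2l // addrA.
by apply/rpredDr/dvdz_mulr; rewrite dvdzE /= dvdn_exp.
Qed.

Lemma nroots1 (u v : int) : nroots u v 1 = 1%N.
Proof. by rewrite /nroots big_ord_recl big_ord0 dvd1z. Qed.

Lemma nroots_congr (u v w : int) (m : nat) : (m%:Z %| v - w)%Z ->
  nroots u v m = nroots u w m.
Proof.
move=> h; apply: eq_bigr => x _; congr nat_of_bool; apply: dvdz_congr.
by rewrite /quad opprD addrACA subrr add0r.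
Qed.

(** Completing the square: 4 (x^2 + ux + v) = (2x + u)^2 - (u^2 - 4v), where 2 is
invertible modulo [m]. *)
Lemma nroots_odd (u v : int) (m : nat) : odd m ->
  nroots u v m = nroots 0 (4 * v - u ^+ 2) m.
Proof.
move=> om; have cm2 : coprimez m 2.
  by rewrite /coprimez /gcdz eqz_nat /= -/(coprime _ _) coprimen2.
rewrite [RHS](esym (reindex_affine u
  (fun s => nat_of_bool (m%:Z %| quad 0 (4 * v - u ^+ 2) s%:Z)%Z) cm2)).
apply: eq_bigr => x _; congr nat_of_bool.
have m0 : m%:Z != 0 by case: (m) om.
rewrite gez0_abs ?modz_ge0 //.
rewrite [RHS](@dvdz_quad_congr _ _ _ _ (u + 2 * x%:Z)); last first.
  by rewrite -eqz_mod_dvd; apply/eqP; exact: modz_mod.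
have -> : quad 0 (4 * v - u ^+ 2) (u + 2 * x%:Z) = 2 * (2 * quad u v x%:Z).
  by rewrite /quad; ring.
by rewrite !Gauss_dvdzr.
Qed.

Lemma nroots_unit_ppow (u v : int) (p k : nat) : prime p ->
  ~~ (p%:Z %| u ^+ 2 - 4 * v)%Z -> nroots u v (p ^ k.+1) = nroots u v p.
Proof.
move=> pp npd; elim: k => [|k IH]; first by rewrite expn1.
by rewrite nroots_hensel.
Qed.

Lemma nroots_periodic (u v : int) (k m : nat) :
  (\sum_(x < k * m) nat_of_bool (m%:Z %| quad u v x%:Z)%Z =
   k * nroots u v m)%N.
Proof.
rewrite (sum_ord_block (fun x => nat_of_bool (m%:Z %| quad u v x%:Z)%Z)
  (erefl (k * m)%N)).
rewrite /nroots big_distrr /=; apply: eq_bigr => y _.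
rewrite (eq_bigr (fun=> nat_of_bool (m%:Z %| quad u v y%:Z)%Z)).
  by rewrite sum_nat_const card_ord.
move=> t _; congr nat_of_bool; apply: dvdz_quad_congr.
by rewrite PoszD PoszM addrC addKr dvdz_mulr.
Qed.

Lemma dvdz_prime_sqr (p : nat) (a : int) : prime p ->
  (p%:Z %| a ^+ 2)%Z = (p%:Z %| a)%Z.
Proof. by move=> pp; rewrite expr2 dvdz_prime_mul // orbb. Qed.

Lemma nroots_prime_nonsquare (p : nat) (D : int) :
  (forall x : int, ~~ (p%:Z %| x ^+ 2 - D)%Z) -> nroots 0 (- D) p = 0%N.
Proof.
move=> h; apply: big1 => x _; apply/eqP; rewrite eqb0.
by rewrite /quad mul0r addr0 h.
Qed.

(** Modulo p the polynomial t^2 - D factors as (t - y)(t + y), and the two roots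
differ as p does not divide 2y. *)
Lemma nroots_prime_square (p : nat) (D y : int) : prime p -> odd p ->
  ~~ (p%:Z %| D)%Z -> (p%:Z %| y ^+ 2 - D)%Z -> nroots 0 (- D) p = 2%N.
Proof.
move=> pp op npD hy.
have npy : ~~ (p%:Z %| y)%Z.
  apply: contra npD => h; rewrite -(rpredBl D (x := y ^+ 2)) //.
  by rewrite expr2 dvdz_mulr.
have np1 : ~~ (p%:Z %| 1)%Z by rewrite dvdz1 /=; case: p pp {npD hy npy op} => [|[]].
transitivity (\sum_(t < p) nat_of_bool (p%:Z %| (- y + 1 * t%:Z)%R)%Z +
              \sum_(t < p) nat_of_bool (p%:Z %| (y + 1 * t%:Z)%R)%Z)%N; last first.
  by rewrite !count_linear_root.
rewrite -big_split /=; apply: eq_bigr => t _.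
rewrite !mul1r /quad mul0r addr0.
have -> : (p%:Z %| t%:Z ^+ 2 - D)%Z =
    (p%:Z %| - y + t%:Z)%Z || (p%:Z %| y + t%:Z)%Z.
  rewrite -dvdz_prime_mul //; apply: dvdz_congr.
  by have -> : t%:Z ^+ 2 - D - (- y + t%:Z) * (y + t%:Z) = y ^+ 2 - D by ring.
case h1 : (p%:Z %| _)%Z; case h2 : (p%:Z %| _)%Z => //; exfalso.
have : (p%:Z %| 2 * y)%Z.
  have -> : 2 * y = (y + t%:Z) - (- y + t%:Z) by ring.
  by rewrite rpredB.
rewrite dvdz_prime_mul // (negPf npy) orbF dvdzE /= dvdn_prime2 // => /eqP p2.
by rewrite p2 in op.
Qed.

(** A root x modulo p^(j+2) is divisible by p; its quotient y by p is determined
modulo p^(j+1) and subject to a condition modulo p^j, whence the factor p. *)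
Lemma nroots_p2D (p j : nat) (D : int) : prime p ->
  nroots 0 (- (p%:Z ^+ 2 * D)) (p ^ j.+2) = (p * nroots 0 (- D) (p ^ j))%N.
Proof.
move=> pp; have p0 : p%:Z != 0 by rewrite eqz_nat -lt0n prime_gt0.
rewrite -nroots_periodic -expnS /nroots.
rewrite (sum_ord_block
  (fun x => nat_of_bool ((p ^ j.+2)%N%:Z %| quad 0 (- (p%:Z ^+ 2 * D)) x%:Z)%Z)
  (expnSr p j.+1)).
(* Only the residue y = 0 modulo p contributes. *)
case: p pp p0 => // p pp p0; rewrite big_ord_recl [X in (_ + X)%N]big1 => [|y _].
  rewrite addn0; apply: eq_bigr => t _; congr nat_of_bool.
  rewrite [(ord0 + _)%N]/(0 + p.+1 * t)%N.
  have -> : quad 0 (- (p.+1%:Z ^+ 2 * D)) (0 + p.+1 * t)%N%:Z =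
      p.+1%:Z * (p.+1%:Z * quad 0 (- D) t%:Z).
    by rewrite /quad PoszD PoszM /=; ring.
  have -> : (p.+1 ^ j.+2)%N%:Z = p.+1%:Z * (p.+1%:Z * (p.+1 ^ j)%N%:Z).
    by rewrite -!PoszM -!expnS.
  by rewrite !dvdz_mul2l.
apply: big1 => t _; apply/eqP; rewrite eqb0; apply/negP => h.
have : (p.+1%:Z %| quad 0 (- (p.+1%:Z ^+ 2 * D)) (lift ord0 y + p.+1 * t)%N%:Z)%Z.
  by apply: dvdz_trans h; rewrite dvdzE /= dvdn_exp.
rewrite (@dvdz_quad_congr _ _ _ _ ((lift ord0 y)%:Z)); last first.
  by rewrite PoszD PoszM addrC addKr dvdz_mulr.
rewrite /quad mul0r addr0 rpredBr; last by rewrite expr2 -mulrA dvdz_mulr.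
rewrite dvdz_prime_sqr // dvdzE /= gtnNdvd //.
by rewrite /bump /= add1n ltnS.
Qed.

(** A root would be divisible by p, and then p^2 would divide pD. *)
Lemma nroots_pD (p j : nat) (D : int) : prime p -> ~~ (p%:Z %| D)%Z ->
  nroots 0 (- (p%:Z * D)) (p ^ j.+2) = 0%N.
Proof.
move=> pp npD; have p0 : p%:Z != 0 by rewrite eqz_nat -lt0n prime_gt0.
apply: big1 => x _; apply/eqP; rewrite eqb0; apply: contra npD.
rewrite /quad mul0r addr0 => h.
have h2 : (p%:Z * p%:Z %| x%:Z ^+ 2 - p%:Z * D)%Z.
  by apply: dvdz_trans h; rewrite expnS expnS !PoszM mulrA dvdz_mulr.
have px : (p%:Z %| x%:Z)%Z.
  rewrite -(dvdz_prime_sqr _ pp) -(rpredBr (x := p%:Z * D)) ?dvdz_mulr //.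
  by apply: dvdz_trans h2; rewrite dvdz_mulr.
rewrite -(dvdz_mul2l p0) -(rpredBl _ (x := x%:Z ^+ 2)) //.
by rewrite expr2 dvdz_mul.
Qed.

Lemma nroots_p_dvd (p : nat) (D : int) : prime p -> (p%:Z %| D)%Z ->
  nroots 0 (- D) p = 1%N.
Proof.
move=> pp pD; rewrite -[RHS](count_linear_root 0 (b := 1) pp); last first.
  by rewrite dvdz1 /=; case: p pp {pD} => [|[]].
apply: eq_bigr => x _; congr nat_of_bool.
by rewrite /quad mul0r addr0 rpredBr // dvdz_prime_sqr // add0r mul1r.
Qed.

Lemma nroots_two (D : int) : nroots 0 (- D) 2 = 1%N.
Proof. rewrite /nroots !big_ord_recl big_ord0 /quad /= /bump /=; lia. Qed.

(** A root is odd, x = 1 + 2t, and x^2 - (1 - 4v) = 4 (t^2 + t + v).  The new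
polynomial has odd discriminant; the factor 2 appears because t is taken modulo
2^(j+1) for a condition modulo 2^j. *)
Lemma nroots_1mod4 (v : int) (j : nat) :
  nroots 0 (- (1 - 4 * v)) (2 ^ j.+2) = (2 * nroots 1 v (2 ^ j))%N.
Proof.
rewrite -nroots_periodic -expnS /nroots.
rewrite (sum_ord_block
  (fun x => nat_of_bool ((2 ^ j.+2)%N%:Z %| quad 0 (- (1 - 4 * v)) x%:Z)%Z)
  (expnSr 2 j.+1)).
rewrite !big_ord_recl big_ord0 addn0 big1 ?add0n => [|t _]; last first.
  apply/eqP; rewrite eqb0; apply/negP => h.
  have : (2 %| quad 0 (- (1 - 4 * v)) (2 * t)%N%:Z)%Z.
    by apply: dvdz_trans h; rewrite dvdzE /= dvdn_exp.
  by rewrite /quad; lia.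
apply: eq_bigr => t _; congr nat_of_bool.
have -> : quad 0 (- (1 - 4 * v)) (1 + 2 * t)%N%:Z = 2 * (2 * quad 1 v t%:Z).
  by rewrite /quad PoszD PoszM; ring.
have -> : (2 ^ j.+2)%N%:Z = 2 * (2 * (2 ^ j)%N%:Z) :> int.
  by rewrite -!PoszM -!expnS.
by rewrite !dvdz_mul2l.
Qed.

Lemma nroots_3mod4 (v : int) (j : nat) :
  nroots 0 (- (3 + 4 * v)) (2 ^ j.+2) = 0%N.
Proof.
apply: big1 => x _; apply/eqP; rewrite eqb0; apply/negP => h.
have : (4 %| quad 0 (- (3 + 4 * v)) x%:Z)%Z.
  by apply: dvdz_trans h; rewrite dvdzE /= (dvdn_exp2l 2 (_ : 2 <= j.+2)%N).
rewrite /quad mul0r addr0.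
case: (boolP (odd x)) => ox.
  have -> : x = (1 + 2 * x./2)%N :> nat by rewrite mul2n -[LHS](odd_double_half x) ox.
  rewrite PoszD PoszM; lia.
have -> : x = (2 * x./2)%N :> nat by rewrite mul2n -[LHS](odd_double_half x) (negPf ox).
rewrite PoszM; lia.
Qed.

Lemma nroots_1_two (v : int) :
  nroots 1 v 2 = if (2 %| v)%Z then 2%N else 0%N.
Proof. by rewrite /nroots !big_ord_recl big_ord0 /quad /= /bump /=; case: ifP; lia. Qed.

(** * The class number at a prime power *)

Definition sum_step2 (s : nat -> nat) (n : nat) : nat :=
  (\sum_(i < n./2.+1) s (n - 2 * i))%N.

Lemma sum_step20 (s : nat -> nat) : sum_step2 s 0 = s 0%N.
Proof. by rewrite /sum_step2 big_ord_recl big_ord0 addn0. Qed.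

Lemma sum_step21 (s : nat -> nat) : sum_step2 s 1 = s 1%N.
Proof. by rewrite /sum_step2 big_ord_recl big_ord0 addn0. Qed.

Lemma sum_step2SS (s : nat -> nat) (n : nat) :
  sum_step2 s n.+2 = (s n.+2 + sum_step2 s n)%N.
Proof.
rewrite /sum_step2 big_ord_recl muln0 subn0; congr addn; apply: eq_bigr => i _.
by rewrite lift0 mulnS.
Qed.

Lemma nat_ind2 (P : nat -> Prop) :
  P 0%N -> P 1%N -> (forall n, P n -> P n.+2) -> forall n, P n.
Proof.
move=> P0 P1 P2 n; have [] // : P n /\ P n.+1.
by elim: n => // n [Pn Pn1]; split=> //; apply: P2.
Qed.

Lemma sum_step2_eventually_const (s : nat -> nat) (r n : nat) : s 0%N = 1%N ->
  (forall k, s k.+1 = r) -> sum_step2 s n = (~~ odd n + r * uphalf n)%N.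
Proof.
move=> s0 sr; elim/nat_ind2: n => [||n IH].
- by rewrite sum_step20 s0 muln0.
- by rewrite sum_step21 sr muln1.
- by rewrite sum_step2SS IH sr /= negbK mulnS addnCA.
Qed.

(** The number of classes for p^n: the index i of the sum stands for the content
t = p^i. *)
Definition class_sum (u v : int) (p n : nat) : nat :=
  sum_step2 (fun j => nroots u v (p ^ j)) n.

Lemma class_sum0 (u v : int) (p : nat) : class_sum u v p 0 = 1%N.
Proof. by rewrite /class_sum sum_step20 expn0 nroots1. Qed.

Lemma class_sum1 (u v : int) (p : nat) : class_sum u v p 1 = nroots u v p.
Proof. by rewrite /class_sum sum_step21 expn1. Qed.

Lemma class_sum_unit (u v : int) (p n : nat) : prime p ->
  ~~ (p%:Z %| u ^+ 2 - 4 * v)%Z ->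
  class_sum u v p n = (~~ odd n + nroots u v p * uphalf n)%N.
Proof.
move=> pp npd; apply: sum_step2_eventually_const; first by rewrite expn0 nroots1.
by move=> k; apply: nroots_unit_ppow.
Qed.

Lemma class_sum_odd (u v : int) (p n : nat) : odd p ->
  class_sum u v p n = class_sum 0 (4 * v - u ^+ 2) p n.
Proof.
by move=> op; apply: eq_bigr => i _; rewrite nroots_odd // oddX op orbT.
Qed.

(** By [nroots_p2D] the terms with index at least 2 are p times those for D; the one
remaining term, of index 0 or 1, equals 1. *)
Lemma class_sum_p2D (p n : nat) (D : int) : prime p ->
  class_sum 0 (- (p%:Z ^+ 2 * D)) p n.+2 = (1 + p * class_sum 0 (- D) p n)%N.
Proof.
move=> pp; elim/nat_ind2: n => [||n IH]; rewrite /class_sum sum_step2SS nroots_p2D //.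
- by rewrite !sum_step20 addnC expn0 nroots1.
- rewrite !sum_step21 addnC expn1 nroots_p_dvd //.
  by rewrite expr2 -mulrA dvdz_mulr.
- by rewrite -/(class_sum _ _ _ _) IH sum_step2SS mulnDr addnCA.
Qed.

Definition geom_sum (p k : nat) : nat := (\sum_(i < k) p ^ i)%N.

Lemma geom_sumS (p k : nat) : geom_sum p k.+1 = (1 + p * geom_sum p k)%N.
Proof.
rewrite /geom_sum big_ord_recl expn0 big_distrr; congr addn.
by apply: eq_bigr => i _; rewrite lift0 expnS.
Qed.

Lemma class_sum_p2e (p e n : nat) (D : int) : prime p ->
  class_sum 0 (- (p%:Z ^+ (2 * e) * D)) p (2 * e + n) =
  (geom_sum p e + p ^ e * class_sum 0 (- D) p n)%N.
Proof.
move=> pp; elim: e => [|e IH].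
  by rewrite muln0 mul1r /geom_sum big_ord0 mul1n.
rewrite (_ : (2 * e.+1 + n)%N = (2 * e + n).+2); last lia.
rewrite mulnS exprD -mulrA.
by rewrite class_sum_p2D // IH geom_sumS mulnDr addnA expnS mulnA.
Qed.

Lemma class_sum_zero (p n : nat) : prime p ->
  class_sum 0 (- 0) p n = geom_sum p n./2.+1.
Proof.
move=> pp; elim/nat_ind2: n => [||n IH].
- by rewrite class_sum0 /geom_sum big_ord_recl big_ord0.
- by rewrite class_sum1 nroots_p_dvd // /geom_sum big_ord_recl big_ord0.
- by rewrite -[X in - X](mulr0 (p%:Z ^+ 2)) class_sum_p2D // IH -geom_sumS.
Qed.

Lemma class_sum_dvd (p n : nat) (D : int) : (p%:Z ^+ n %| D)%Z ->
  class_sum 0 (- D) p n = class_sum 0 (- 0) p n.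
Proof.
move=> h; apply: eq_bigr => i _; apply: nroots_congr.
rewrite oppr0 subr0 rpredN; apply: dvdz_trans h.
by rewrite dvdzE abszX /= dvdn_exp2l // leq_subr.
Qed.

Lemma class_sum_pD (p n : nat) (D : int) : prime p -> ~~ (p%:Z %| D)%Z ->
  class_sum 0 (- (p%:Z * D)) p n = 1%N.
Proof.
move=> pp npD; elim/nat_ind2: n => [||n IH]; first by rewrite class_sum0.
  by rewrite class_sum1 nroots_p_dvd // dvdz_mulr.
by rewrite /class_sum sum_step2SS -/(class_sum _ _ _ _) IH nroots_pD.
Qed.

Lemma class_sum_2_3mod4 (n : nat) (v : int) : class_sum 0 (- (3 + 4 * v)) 2 n = 1%N.
Proof.
elim/nat_ind2: n => [||n IH]; first by rewrite class_sum0.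
  by rewrite class_sum1 nroots_two.
by rewrite /class_sum sum_step2SS -/(class_sum _ _ _ _) IH nroots_3mod4.
Qed.

(** By [nroots_1mod4] the terms with index at least 2 are twice those for
x^2 + x + v; the remaining one equals 1. *)
Lemma class_sum_2_1mod4 (n : nat) (v : int) :
  class_sum 0 (- (1 - 4 * v)) 2 n.+2 = (1 + 2 * class_sum 1 v 2 n)%N.
Proof.
elim/nat_ind2: n => [||n IH]; rewrite /class_sum sum_step2SS nroots_1mod4 //.
- by rewrite !sum_step20 expn0 !nroots1.
- by rewrite !sum_step21 expn1 nroots_two addnC.
- by rewrite -/(class_sum _ _ _ _) IH sum_step2SS mulnDr addnCA.
Qed.

(** * Sums over divisors *)

(** The inverse of (a, b) -> ab sends t to (gcd(t, m), gcd(t, n)). *)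
Lemma sum_divisors_coprime (m n : nat) (T : nmodType) (F : nat -> T) :
  (0 < m)%N -> (0 < n)%N -> coprime m n ->
  \sum_(t <- divisors (m * n)) F t =
  \sum_(a <- divisors m) \sum_(b <- divisors n) F (a * b)%N.
Proof.
move=> m0 n0 cmn.
transitivity
  (\sum_(t <- [seq (a * b)%N | a <- divisors m, b <- divisors n]) F t).
  apply: perm_big; apply: uniq_perm; first exact: divisors_uniq.
    apply: allpairs_uniq; rewrite ?divisors_uniq // => -[a b] [a' b'].
    case/allpairsP=> [[i j]] /= [+ + [-> ->]] {a b}; rewrite -!dvdn_divisors //.
    move=> im jn.
    case/allpairsP=> [[k l]] /= [+ + [-> ->]] {a' b'}; rewrite -!dvdn_divisors //.
    move=> km ln e.
    have gcdl a b : (a %| m -> b %| n -> gcdn m (a * b) = a)%N.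
      by move=> am bn; rewrite Gauss_gcdl ?(coprime_dvdr bn) //; apply/gcdn_idPr.
    have gcdr a b : (a %| m -> b %| n -> gcdn n (a * b) = b)%N.
      move=> am bn; rewrite Gauss_gcdr; first exact/gcdn_idPr.
      by rewrite coprime_sym (coprime_dvdl am).
    by rewrite -(gcdl i j) // -[in RHS](gcdl k l) // -{2}(gcdr i j) //
       -{2}(gcdr k l) // e.
  move=> t; rewrite -dvdn_divisors ?muln_gt0 ?m0 //.
  apply/idP/allpairsP => [tmn|[[a b]] /= [+ + ->]]; last first.
    by rewrite -!dvdn_divisors //; apply: dvdn_mul.
  exists (gcdn t m, gcdn t n); split => /=; rewrite -?dvdn_divisors ?dvdn_gcdr //.
  apply/eqP; rewrite eqn_dvd Gauss_dvd ?dvdn_gcdl ?andbT; last first.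
    by rewrite (coprime_dvdl (dvdn_gcdr t m)) // (coprime_dvdr (dvdn_gcdr t n)).
  rewrite muln_gcdl dvdn_gcd dvdn_mulr //= muln_gcdr dvdn_gcd tmn andbT.
  by rewrite dvdn_mull.
by rewrite big_allpairs_dep.
Qed.

Lemma sum_divisors_ppow (p n : nat) (T : nmodType) (F : nat -> T) : prime p ->
  \sum_(t <- divisors (p ^ n)) F t = \sum_(i < n.+1) F (p ^ i)%N.
Proof.
move=> pp; transitivity (\sum_(t <- [seq (p ^ i)%N | i <- iota 0 n.+1]) F t).
  apply: perm_big; apply: uniq_perm; first exact: divisors_uniq.
    rewrite map_inj_uniq ?iota_uniq // => i j /eqP.
    by rewrite eqn_exp2l ?prime_gt1 // => /eqP.
  move=> t; rewrite -dvdn_divisors ?expn_gt0 ?prime_gt0 //.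
  apply/(dvdn_pfactor _ _ pp)/mapP => [[i le ->]|[i + ->]].
    by exists i => //; rewrite mem_iota.
  by rewrite mem_iota ltnS => le; exists i.
by rewrite big_map -[iota _ _]/(index_iota 0 n.+1) big_mkord.
Qed.

(** By [class_count] this is C(d, m) for d = u^2 - 4v; the index t is the content
of the represented vector. *)
Definition nclasses (u v : int) (m : nat) : nat :=
  (\sum_(t <- divisors m | t ^ 2 %| m) nroots u v (m %/ t ^ 2))%N.

Lemma nclasses_ppow (u v : int) (p n : nat) : prime p ->
  nclasses u v (p ^ n) = class_sum u v p n.
Proof.
move=> pp; rewrite /nclasses big_mkcond (sum_divisors_ppow n _ pp) /=.
rewrite /class_sum /sum_step2.
rewrite (big_ord_widen n.+1 (fun i => nroots u v (p ^ (n - 2 * i)))); last lia.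
rewrite [RHS]big_mkcond; apply: eq_bigr => i _.
rewrite -expnM dvdn_Pexp2l ?prime_gt1 //.
have -> : (i * 2 <= n)%N = (i < n./2.+1)%N by lia.
by case: ifP => // le; rewrite -expnB ?prime_gt0 ?(mulnC 2) //; lia.
Qed.

Lemma nclassesM (u v : int) (m n : nat) : (0 < m)%N -> (0 < n)%N ->
  coprime m n -> nclasses u v (m * n) = (nclasses u v m * nclasses u v n)%N.
Proof.
move=> m0 n0 cmn; rewrite /nclasses big_mkcond.
rewrite (sum_divisors_coprime _ m0 n0 cmn) /= [X in _ = (X * _)%N]big_mkcond.
rewrite [X in _ = (_ * X)%N]big_mkcond big_distrl /=.
rewrite big_seq [RHS]big_seq; apply: eq_bigr => a; rewrite -dvdn_divisors // => am.
rewrite big_distrr /= big_seq [RHS]big_seq.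
apply: eq_bigr => b; rewrite -dvdn_divisors // => bn.
have can : coprime (a ^ 2) n by rewrite coprimeXl // (coprime_dvdl am).
have cmb : coprime m (b ^ 2) by rewrite coprimeXr // (coprime_dvdr bn).
have cab : coprime (a ^ 2) (b ^ 2) by rewrite coprimeXl // (coprime_dvdl am).
rewrite expnMn Gauss_dvd // Gauss_dvdl // Gauss_dvdr 1?coprime_sym //.
case: ifP => [/andP[ha hb]|/negbT]; last first.
  by rewrite negb_and => /orP[]/negPf->; rewrite ?muln0.
rewrite ha hb -nrootsM; last first.
  rewrite (@coprime_dvdl _ m) ?dvdn_div // (@coprime_dvdr _ n) ?dvdn_div //.
congr nroots; rewrite -{1}(divnK ha) -{1}(divnK hb) mulnACA mulnK //.
by rewrite muln_gt0 !expn_gt0 (dvdn_gt0 m0 am) (dvdn_gt0 n0 bn).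
Qed.

(** * Reduction of a represented vector *)

Lemma ord2P (i : 'I_2) : i = 0 \/ i = 1.
Proof. by case: i => -[|[|//]] h; [left|right]; apply: val_inj. Qed.

Lemma sum_ord2 (F : 'I_2 -> int) : \sum_i F i = F 0 + F 1.
Proof.
rewrite !big_ord_recl big_ord0 addr0; congr (F _ + F _); exact: val_inj.
Qed.

Lemma det_2x2 (g : 'M[int]_2) : \det g = g 0 0 * g 1 1 - g 0 1 * g 1 0.
Proof.
rewrite (expand_det_row _ 0) sum_ord2 /cofactor !det_mx11 !mxE /=.
have -> : lift 0 0 = 1 :> 'I_2 by exact: val_inj.
have -> : lift 1 0 = 0 :> 'I_2 by exact: val_inj.
by rewrite /= expr0 expr1; ring.
Qed.

Definition mx22 (a b c e : int) : 'M[int]_2 :=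
  \matrix_(i, j) if i == 0 then if j == 0 then a else b
                 else if j == 0 then c else e.

(** The vector (t, 0). *)
Definition ray (t : int) : 'cV[int]_2 := \col_i if i == 0 then t else 0.

Lemma mul_col2 (g : 'M[int]_2) (z : 'cV[int]_2) (i : 'I_2) :
  (g *m z) i 0 = g i 0 * z 0 0 + g i 1 * z 1 0.
Proof. by rewrite mxE sum_ord2. Qed.

Lemma eq_col2 (y z : 'cV[int]_2) :
  y 0 0 = z 0 0 -> y 1 0 = z 1 0 -> y = z.
Proof. by move=> h0 h1; apply/colP => i; case: (ord2P i) => ->. Qed.

Lemma bqf_actM (f : bqf) (g h : 'M[int]_2) :
  bqf_act (bqf_act f g) h = bqf_act f (g *m h).
Proof.
case: f => [[a b] c]; rewrite /bqf_act !mxE !sum_ord2.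
by congr (_, _, _); ring.
Qed.

Lemma bqf_act1 (f : bqf) : bqf_act f 1%:M = f.
Proof. by case: f => [[a b] c]; rewrite /bqf_act !mxE /=; congr (_, _, _); ring. Qed.

Lemma bqf_disc_act (f : bqf) (g : 'M[int]_2) :
  bqf_disc (bqf_act f g) = \det g ^+ 2 * bqf_disc f.
Proof. by case: f => [[a b] c]; rewrite det_2x2 /bqf_act /bqf_disc; ring. Qed.

Lemma SL2Z_unit (g : 'M[int]_2) : SL2Z g -> g \in unitmx.
Proof. by move=> dg; rewrite unitmxE dg unitr1. Qed.

Lemma SL2Z_mul (g h : 'M[int]_2) : SL2Z g -> SL2Z h -> SL2Z (g *m h).
Proof. by move=> dg dh; rewrite /SL2Z /= det_mulmx dg dh mulr1. Qed.

Lemma SL2Z_inv (g : 'M[int]_2) : SL2Z g -> SL2Z (invmx g).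
Proof. by move=> dg; rewrite /SL2Z /= det_inv dg invr1. Qed.

Lemma bqf_actK (f : bqf) (g : 'M[int]_2) : SL2Z g ->
  bqf_act (bqf_act f g) (invmx g) = f.
Proof. by move=> /SL2Z_unit ug; rewrite bqf_actM mulmxV // bqf_act1. Qed.

(** Bezout coefficients of the two coordinates divided by their gcd complete the
primitive vector to a matrix of determinant 1. *)
Lemma ray_reduction (z : 'cV[int]_2) : z != 0 ->
  exists g (t : nat), [/\ SL2Z g, (0 < t)%N & z = g *m ray t].
Proof.
move=> z0.
pose t := gcdz (z 0 0) (z 1 0).
have t0 : t != 0.
  apply: contra z0; rewrite /t gcdz_eq0 => /andP[/eqP h0 /eqP h1].
  by apply/eqP/eq_col2; rewrite mxE.
have /dvdzP[x Ex] := dvdz_gcdl (z 0 0) (z 1 0).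
have /dvdzP[y Ey] := dvdz_gcdr (z 0 0) (z 1 0).
rewrite -/t in Ex Ey.
have [r [s rs]] := Bezoutz (z 0 0) (z 1 0).
rewrite -/t Ex Ey in rs.
have rs1 : r * x + s * y = 1.
  by apply: (mulIf t0); rewrite mul1r -[RHS]rs; ring.
exists (mx22 x (- s) y r), `|t|%N; split.
- by rewrite /SL2Z /= det_2x2 !mxE /= -rs1; ring.
- by rewrite absz_gt0.
- have -> : `|t|%N%:Z = t by rewrite gez0_abs.
  by apply: eq_col2; rewrite mul_col2 !mxE /= mulr0 addr0.
Qed.

(** The form [a, 2x + u, c] whose discriminant is u^2 - 4v, for a dividing
x^2 + ux + v. *)
Definition form_at (u v a x : int) : bqf := (a, 2 * x + u, (quad u v x %/ a)%Z).

Lemma form_at_disc (u v a x : int) : (a %| quad u v x)%Z ->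
  bqf_disc (form_at u v a x) = u ^+ 2 - 4 * v.
Proof.
move=> h; rewrite /bqf_disc /form_at -mulrA (mulrC a) (divzK h) /quad; ring.
Qed.

Lemma form_at_ray (u v a x t : int) : bqf_eval (form_at u v a x) (ray t) = a * t ^+ 2.
Proof. by rewrite /bqf_eval /form_at !mxE /=; ring. Qed.

(** The middle coefficient has the parity of u, as its square is congruent to u^2
modulo 4; translations change it by multiples of twice the leading coefficient. *)
Lemma form_reduction (u v : int) (f : bqf) : f.1.1 != 0 ->
  bqf_disc f = u ^+ 2 - 4 * v ->
  exists k (x : nat), [/\ (x < `|f.1.1|)%N, (f.1.1 %| quad u v x)%Z &
    bqf_act f (mx22 1 k 0 1) = form_at u v f.1.1 x].
Proof.
case: f => [[a b] c] /= a0 hd.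
have [w bw] : exists w, b = 2 * w + u.
  have : (2 %| (b - u) * (b - u))%Z.
    apply/dvdzP; exists (2 * (a * c - v) + u ^+ 2 - b * u).
    have -> : (b - u) * (b - u) = b ^+ 2 + u ^+ 2 - 2 * (b * u) by ring.
    have -> : b ^+ 2 = u ^+ 2 - 4 * v + 4 * a * c by rewrite -hd; ring.
    by ring.
  rewrite dvdz_prime_mul // orbb => /dvdzP[w Ew].
  by exists w; rewrite mulrC -Ew subrK.
have qw : quad u v w = a * c.
  apply: (@mulfI _ 4) => //.
  have -> : 4 * (a * c) = b ^+ 2 - (u ^+ 2 - 4 * v) by rewrite -hd; ring.
  by rewrite bw /quad; ring.
pose k := - (w %/ a)%Z; pose x := (w %% a)%Z.
have Ew : w = x - k * a by rewrite {1}(divz_eq w a) /k mulNr opprK addrC.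
have x0 : 0 <= x by exact: modz_ge0.
have ax : (a %| quad u v x)%Z.
  rewrite -(dvdz_quad_congr u v (a := w)) ?qw ?dvdz_mulr //.
  by rewrite Ew addrAC subrr add0r rpredN dvdz_mull.
exists k, `|x|%N; rewrite gez0_abs //; split=> //.
  by have := ltz_mod w a0; rewrite -/x; lia.
rewrite /bqf_act /form_at !mxE /=; congr (_, _, _).
- ring.
- by rewrite bw Ew; ring.
- apply: (mulfI a0); rewrite [RHS]mulrC divzK //.
  have -> : a * (a * k ^+ 2 + b * k * 1 + c * 1 ^+ 2) =
     (a * k) ^+ 2 + a * k * b + a * c by ring.
  by rewrite -qw bw Ew /quad; ring.
Qed.

Lemma ray_stab (g : 'M[int]_2) (s t : nat) : SL2Z g -> (0 < s)%N -> (0 < t)%N ->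
  g *m ray s = ray t -> s = t /\ exists k, g = mx22 1 k 0 1.
Proof.
move=> dg s0 t0 e.
have e0 : g 0 0 * s%:Z = t%:Z.
  by have := congr1 (fun z : 'cV[int]_2 => z 0 0) e; rewrite mul_col2 !mxE /= mulr0 addr0.
have e1 : g 1 0 = 0.
  have := congr1 (fun z : 'cV[int]_2 => z 1 0) e; rewrite mul_col2 !mxE /= mulr0 addr0.
  by move=> /eqP; rewrite mulf_eq0 => /orP[/eqP //|]; rewrite eqz_nat; case: (s) s0.
have := dg; rewrite /SL2Z /= det_2x2 e1 mulr0 subr0 => d1.
have g00_gt0 : 0 < g 0 0.
  have s0' : 0 < s%:Z by [].
  by rewrite -(pmulr_lgt0 _ s0') e0.
have g00 : g 0 0 = 1.
  have g11_gt0 : 0 < g 1 1 by rewrite -(pmulr_rgt0 _ g00_gt0) d1.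
  by move: (g 0 0) (g 1 1) g00_gt0 g11_gt0 d1 => a b; nia.
have g11 : g 1 1 = 1 by rewrite g00 mul1r in d1.
split; first by move: e0; rewrite g00 mul1r => -[].
exists (g 0 1); apply/matrixP => i j.
by case: (ord2P i) => ->; case: (ord2P j) => ->; rewrite mxE.
Qed.

Lemma form_at_translate (u v a x y k : int) :
  bqf_act (form_at u v a x) (mx22 1 k 0 1) = form_at u v a y -> (a %| x - y)%Z.
Proof.
rewrite /bqf_act /form_at !mxE /= => -[_ e _].
apply/dvdzP; exists (- k); apply: (@mulfI _ 2) => //.
have -> : 2 * (x - y) = 2 * x + u - (2 * y + u) by ring.
by rewrite -e; ring.
Qed.

(** * The class number as a sum of root counts *)

Lemma residue_inj (a : int) (x y : nat) : (x < `|a|)%N -> (y < `|a|)%N ->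
  (a %| x%:Z - y%:Z)%Z -> x = y.
Proof.
move=> hx hy; rewrite dvdzE -[(_ %| _)%N]/(`|a|%N%:Z %| x%:Z - y%:Z)%Z.
by rewrite -eqz_mod_dvd !modz_nat => /eqP[]; rewrite !modn_small.
Qed.

Lemma esum_seq (R : realType) (T : choiceType) (s : seq T) (F : T -> \bar R) :
  uniq s -> (forall x, (0 <= F x)%E) ->
  \esum_(x in [set` s]) F x = (\sum_(x <- s) F x)%E.
Proof.
move=> us F0; rewrite esum_fset; [|exact: finite_seq|by []].
by rewrite [RHS]fsbig_seq.
Qed.

Lemma counting_esum (R : realType) (T : choiceType) (A : set T) :
  finite_set A -> counting A = \esum_(x in A) (1%:E : \bar R).
Proof.
move=> finA; rewrite /counting asboolT // esum_fset // fsbig_finite //= sumEFin.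
by rewrite big_const_seq count_predT iter_addr addr0.
Qed.

Section ClassCount.
Variables (R : realType) (S : int -> set bqf) (u v m : int).
Let d := u ^+ 2 - 4 * v.
Hypothesis (hS : is_representatives d (S d)) (m0 : m != 0).

(* A class is encoded by the content t and the residue x of a reduced form. *)
Let tset := [seq t <- divisors `|m|%N | (t ^ 2 %| `|m|)%N].
Let xset (t : nat) :=
  [seq x <- iota 0 (`|m| %/ t ^ 2)%N |
     ((`|m| %/ t ^ 2)%N%:Z %| quad u v x%:Z)%Z].
Let lead (t : nat) := (m %/ t%:Z ^+ 2)%Z.
Let base (c : nat * nat) := form_at u v (lead c.1) c.2%:Z.
Let codes := [set` tset] `*`` (fun t => [set` xset t]).

Lemma absz_m_gt0 : (0 < `|m|)%N. Proof. by rewrite absz_gt0. Qed.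

Lemma absz_lead (t : nat) : (t ^ 2 %| `|m|)%N -> (`|lead t| = `|m| %/ t ^ 2)%N.
Proof.
move=> h; have hz : (t%:Z ^+ 2 %| m)%Z by rewrite dvdzE abszX.
have t0 : (0 < t ^ 2)%N by apply: dvdn_gt0 h; exact: absz_m_gt0.
by rewrite -[in RHS](divzK hz) abszM abszX mulnK.
Qed.

Lemma codesP (t x : nat) : codes (t, x) <->
  [/\ (0 < t)%N, (t ^ 2 %| `|m|)%N, (x < `|lead t|)%N &
      (lead t %| quad u v x%:Z)%Z].
Proof.
have m1 := absz_m_gt0; rewrite /codes /tset /xset /=; split.
  rewrite !mem_filter mem_iota -dvdn_divisors //=.
  move=> -[/andP[t2 tm] /andP[hq hx]]; rewrite absz_lead //; split=> //.
    exact: dvdn_gt0 tm.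
  by move: hq; rewrite !dvdzE absz_lead.
move=> [t0 t2 hx hq]; rewrite !mem_filter mem_iota -dvdn_divisors // t2 /=.
rewrite -absz_lead // hx andbT; split; last by rewrite dvdzE.
by apply: dvdn_trans t2; rewrite dvdn_exp.
Qed.

Lemma base_disc (c : nat * nat) : codes c -> bqf_disc (base c) = d.
Proof. by case: c => t x /codesP[_ _ _ h]; exact: form_at_disc. Qed.

Lemma lead_mul (t : nat) : (t ^ 2 %| `|m|)%N -> lead t * t%:Z ^+ 2 = m.
Proof. by move=> h; rewrite /lead divzK // dvdzE abszX. Qed.

Lemma base_ray (c : nat * nat) : codes c ->
  bqf_eval (base c) (ray c.1%:Z) = m.
Proof. by case: c => t x /codesP[_ h _ _]; rewrite form_at_ray lead_mul. Qed.

(** A code c is sent to the representative f of its reduced form and the orbit of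
the vector that corresponds to (t, 0) under the chosen change of variables.
Injectivity holds because a matrix that maps one vector (s, 0) to another (t, 0)
is a translation and s = t; surjectivity is the reduction of (f, z). *)
Lemma class_bijection : exists e,
  set_bij codes (S d `*`` (fun f => SO_orbits f m)) e.
Proof.
have [hS1 hS2] := hS.
have /boolp.choice[rep hrep] : forall c : nat * nat, exists hg : bqf * 'M[int]_2,
    codes c -> [/\ S d hg.1, SL2Z hg.2 & hg.1 = bqf_act (base c) hg.2].
  move=> c; have [hc|nc] := pselect (codes c); last by exists ((0, 0, 0), 0).
  have [h [[Sh [g dg hg]] _]] := hS2 _ (base_disc hc).
  by exists (h, g).
exists (fun c => ((rep c).1, SO_orbit (rep c).1 (invmx (rep c).2 *m ray c.1%:Z))).
split.
- move=> c hc; have [S1 dg hg] := hrep c hc; split => //=.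
  exists (invmx (rep c).2 *m ray c.1%:Z) => //=.
  by rewrite {1}hg bqf_eval_act mulKVmx ?SL2Z_unit // base_ray.
- move=> [t x] [s y]; rewrite !inE => hc hc' [e1 e2].
  have [S1 dg hg] := hrep _ hc; have [S1' dg' hg'] := hrep _ hc'.
  set g := (rep (t, x)).2 in dg hg e2; set g' := (rep (s, y)).2 in dg' hg' e2.
  have : SO_orbit (rep (t, x)).1 (invmx g *m ray t%:Z) (invmx g *m ray t%:Z).
    by exists 1%:M; rewrite ?mul1mx //; split; [rewrite /SL2Z /= det1|rewrite bqf_act1].
  rewrite e2 => -[k [dk fk] ek].
  pose w := g *m k *m invmx g'.
  have dw : SL2Z w by apply: SL2Z_mul; [exact: SL2Z_mul|exact: SL2Z_inv].
  have wr : w *m ray s%:Z = ray t%:Z.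
    rewrite /w -!mulmxA; move: ek => /= ->.
    by rewrite mulKVmx // SL2Z_unit.
  have [/codesP[t0 t2 hx hq] /codesP[s0 s2 hy hq']] := (hc, hc').
  have [est [j wj]] := ray_stab dw s0 t0 wr.
  have wf : bqf_act (base (t, x)) w = base (s, y).
    by rewrite /w -!bqf_actM -hg e1 fk hg' bqf_actK.
  move: wf; rewrite wj /base /= est => /form_at_translate.
  move=> h; congr (_, _); rewrite est in hy.
  exact: residue_inj hx hy h.
- move=> [f o] [/= Sf [z fz <-]].
  have z0 : z != 0.
    apply: contra m0 => /eqP z0; rewrite -fz z0; case: (f) => [[a b] c].
    by apply/eqP; rewrite /bqf_eval !mxE; ring.
  have [g1 [t [dg1 t0 Ez]]] := ray_reduction z0.
  pose f1 := bqf_act f g1.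
  have f1m : f1.1.1 * t%:Z ^+ 2 = m.
    rewrite -fz Ez -bqf_eval_act -/f1; case: (f1) => [[a b] c].
    by rewrite /bqf_eval !mxE /=; ring.
  have a0 : f1.1.1 != 0 by apply: contra m0 => /eqP a0; rewrite -f1m a0 mul0r.
  have df1 : bqf_disc f1 = d.
    by rewrite /f1 bqf_disc_act dg1 expr1n mul1r; exact: hS1.
  have [k [x [hx hq hk]]] := form_reduction a0 df1.
  have tlead : lead t = f1.1.1.
    by rewrite /lead -f1m mulzK // expf_neq0 // eqz_nat -lt0n.
  have hc : codes (t, x).
    apply/codesP; rewrite tlead; split => //.
    by rewrite -f1m abszM abszX /= dvdn_mull.
  have [S1 dh hh] := hrep _ hc.
  set h := (rep (t, x)).2 in dh hh.
  pose g := g1 *m mx22 1 k 0 1.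
  have dg : SL2Z g.
    by apply: SL2Z_mul => //; rewrite /SL2Z /= det_2x2 !mxE /=; ring.
  have fg : bqf_act f g = base (t, x) by rewrite /g -bqf_actM hk /base tlead.
  have gz : g *m ray t%:Z = z.
    rewrite Ez /g -mulmxA; congr (_ *m _).
    by apply: eq_col2; rewrite mul_col2 !mxE /= ?mulr0 ?mul0r ?addr0 ?mul1r.
  have rf : (rep (t, x)).1 = f.
    have [f' [_ uniq_f']] := hS2 _ (base_disc hc).
    rewrite -(uniq_f' (rep (t, x)).1); last by split=> //; exists h.
    apply: uniq_f'; split=> //; exists (invmx g); first exact: SL2Z_inv.
    by rewrite -fg bqf_actK.
  exists (t, x) => //=; rewrite rf; congr (_, _).
  have stab : SO f (g *m h).
    by split; [exact: SL2Z_mul|rewrite -bqf_actM fg -hh].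
  set w := g *m h in stab.
  have ew : w *m (invmx h *m ray t%:Z) = z.
    by rewrite /w -mulmxA mulKVmx ?SL2Z_unit.
  have dw : SL2Z w by case: stab.
  apply/seteqP; split => y [l [dl fl] <-].
    exists (l *m invmx w).
      split; first by apply: SL2Z_mul => //; exact: SL2Z_inv.
      by rewrite -bqf_actM fl -{1}stab.2 bqf_actK.
    by rewrite -ew -mulmxA mulKmx // SL2Z_unit.
  exists (l *m w); first by split; [exact: SL2Z_mul|rewrite -bqf_actM fl stab.2].
  by rewrite -mulmxA ew.
Qed.

Lemma class_count : C R S d m = (nclasses u v `|m|)%:R%:E.
Proof.
have [e he] := class_bijection.
have finT t : uniq (xset t) by rewrite filter_uniq // iota_uniq.
have ut : uniq tset by rewrite filter_uniq // divisors_uniq.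
have fincodes : finite_set codes by apply: finite_setXR => *; exact: finite_seq.
have finpairs : finite_set (S d `*`` (fun f => SO_orbits f m)).
  by rewrite -(surj_image_eq (set_bij_sub he) (set_bij_surj he)); exact: finite_image.
transitivity (\esum_(f in S d) \esum_(o in SO_orbits f m) (1%:E : \bar R)).
  apply: eq_esum => f Sf; apply: counting_esum.
  apply: (sub_finite_set _ (finite_image snd finpairs)) => o fo.
  by exists (f, o).
rewrite esum_esum // (reindex_esum _ _ _ _ he) -(esum_esum (a := fun _ _ => 1%:E)) //.
rewrite esum_seq //; last by move=> t; apply: esum_ge0.
transitivity ((\sum_(t <- tset) (size (xset t))%:R%:E)%E : \bar R).
  apply: eq_bigr => t _; rewrite esum_seq // sumEFin.
  by rewrite big_const_seq count_predT iter_addr addr0.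
rewrite sumEFin -natr_sum; congr (_%:R%:E).
rewrite big_filter; apply: eq_bigr => t _.
rewrite size_filter -sum1_count /nroots -[X in iota 0 X]subn0 -/(index_iota _ _).
by rewrite big_mkcond big_mkord /=; apply: eq_bigr => x _; case: ifP.
Qed.
End ClassCount.

(** * Integers coprime to the discriminant *)

Lemma sum_sign_powers (chi : int) (n : nat) : chi = 1 \/ chi = -1 ->
  \sum_(i < n.+1) chi ^+ i = (~~ odd n)%:Z + (1 + chi) * (uphalf n)%:Z.
Proof.
move=> hchi; elim: n => [|n IH]; first by rewrite big_ord_recr big_ord0 /= mulr0.
rewrite big_ord_recr IH /= negbK; case: hchi => ->; last first.
  by rewrite subrr !mul0r !addr0 exprS -signr_odd; case: (odd n).
rewrite expr1n uphalf_half PoszD -[n./2.+1]addn1 PoszD.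
by case: (odd n) => /=; ring.
Qed.

Lemma kronecker_ppow (d : int) (p n : nat) : prime p ->
  kronecker d (p ^ n) = kronecker_prime d p ^+ n.
Proof.
move=> pp; elim: n => [|n IH]; first exact: kronecker1.
rewrite expnS kroneckerM ?expn_gt0 ?prime_gt0 // IH exprS.
by rewrite kronecker_at_prime.
Qed.

Lemma kronecker_prime_sign (d : int) (p : nat) : ~~ (p%:Z %| d)%Z ->
  kronecker_prime d p = 1 \/ kronecker_prime d p = -1.
Proof.
move=> h; rewrite /kronecker_prime /legendre (negPf h).
by case: ifP => _; case: ifP => _; auto.
Qed.

(** For p = 2 the hypothesis forces u = 1, and d = 1 - 4v is 1 modulo 8 exactly
when v is even, that is when x^2 + x + v has a root modulo 2. *)
Lemma nroots_kronecker (u v : int) (p : nat) : u = 0 \/ u = 1 -> prime p ->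
  ~~ (p%:Z %| u ^+ 2 - 4 * v)%Z ->
  (nroots u v p)%:Z = 1 + kronecker_prime (u ^+ 2 - 4 * v) p.
Proof.
move=> hu pp npd; rewrite /kronecker_prime (negPf npd).
case: eqP npd => [->|p2] npd.
  have u1 : u = 1 by case: hu npd => -> //; lia.
  rewrite u1 nroots_1_two; case: ifP => h; case: ifP => // /eqP h'; lia.
have op : odd p by case/even_prime: (pp).
rewrite /legendre (negPf npd) nroots_odd // -opprB.
case: ifP => [/existsP[x hx]|/negbT /existsPn hx].
  by rewrite (nroots_prime_square (y := x%:Z)).
rewrite nroots_prime_nonsquare ?subrr // => x.
have p0 := prime_gt0 pp; apply: contra (hx (Ordinal (ltn_modz x p0))) => h /=.
rewrite gez0_abs; last by apply: modz_ge0; rewrite eqz_nat -lt0n.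
have := dvdz_quad_congr 0 (- (u ^+ 2 - 4 * v)) (m := p%:Z) (a := (x %% p%:Z)%Z) (b := x).
rewrite /quad !mul0r !addr0 => ->//.
by rewrite -eqz_mod_dvd; apply/eqP; exact: modz_mod.
Qed.

(** Both sides are multiplicative, and at p^n both equal the sum of the powers
(d/p)^i for i at most n. *)
Lemma nclasses_kronecker (u v : int) (m : nat) : u = 0 \/ u = 1 -> (0 < m)%N ->
  coprimez m%:Z (u ^+ 2 - 4 * v) ->
  (nclasses u v m)%:Z = \sum_(mu <- divisors m) kronecker (u ^+ 2 - 4 * v) mu.
Proof.
move=> hu; have [k] := ubnP m; elim: k m => // k IH m; rewrite ltnS => mk m0 cmd.
have [m1|m_gt1] := leqP m 1.
  have -> : m = 1%N by lia.
  rewrite -[1%N]/(2 ^ 0)%N nclasses_ppow // class_sum0.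
  by rewrite sum_divisors_ppow // big_ord_recl big_ord0 expn0 kronecker1.
set p := pdiv m; have pp : prime p by exact: pdiv_prime.
have pm : (p %| m)%N by exact: pdiv_dvd.
have [m' cpm' Em] := pfactor_coprime pp m0.
set n := logn p m in Em.
have n_gt0 : (0 < n)%N by rewrite logn_gt0 mem_primes pp m0.
have m'0 : (0 < m')%N by move: m0; rewrite {1}Em muln_gt0 => /andP[].
have pn0 : (0 < p ^ n)%N by rewrite expn_gt0 prime_gt0.
have cm'p : coprime m' (p ^ n) by rewrite coprimeXr // coprime_sym.
have npd : ~~ (p%:Z %| u ^+ 2 - 4 * v)%Z.
  rewrite dvdzE /= -prime_coprime //.
  exact: (coprime_dvdl pm).
rewrite {1 2}Em nclassesM // (sum_divisors_coprime _ m'0 pn0 cm'p) PoszM.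
rewrite IH //; first last.
- apply: (coprimez_dvdl _ cmd); rewrite Em; exact: dvdn_mulr.
- apply: leq_trans mk; rewrite Em ltn_Pmulr // -{1}(expn0 p).
  by rewrite ltn_exp2l // prime_gt1.
rewrite nclasses_ppow // class_sum_unit //.
rewrite big_distrl /= big_seq [RHS]big_seq; apply: eq_bigr => a.
rewrite -dvdn_divisors // => /(dvdn_gt0 m'0) a0.
rewrite sum_divisors_ppow //.
rewrite (eq_bigr (fun i : 'I_n.+1 =>
    kronecker (u ^+ 2 - 4 * v) a * kronecker_prime (u ^+ 2 - 4 * v) p ^+ i)).
  rewrite -big_distrr /= sum_sign_powers; last exact: kronecker_prime_sign.
  by rewrite PoszD PoszM nroots_kronecker.
by move=> i _; rewrite kroneckerM ?kronecker_ppow // expn_gt0 prime_gt0.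
Qed.

(** * Squares of p-adic integers *)

Lemma padic_int_eq (p : nat) (x y : padic_int p) :
  padic_res x =1 padic_res y -> x = y.
Proof.
case: x y => [x hx] [y hy] /= /funext exy; case: _ / exy hy => hy.
by congr PadicInt; exact: Prop_irrelevance.
Qed.

Lemma is_padic_square_lim (p : nat) (d : int) (y : nat -> int) :
  (forall k, (p%:Z ^+ k %| y k.+1 - y k)%Z) ->
  (forall k, (p%:Z ^+ k %| y k ^+ 2 - d)%Z) -> is_padic_square p d.
Proof.
move=> ycoh ysq.
have coh k : ((y k.+1 %% p%:Z ^+ k.+1)%Z %% p%:Z ^+ k)%Z = (y k %% p%:Z ^+ k)%Z.
  by rewrite padic_of_int_coh; apply/eqP; rewrite eqz_mod_dvd.
exists (PadicInt coh); apply: padic_int_eq => k /=.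
by rewrite modzMm -expr2; apply/esym/eqP; rewrite eqz_mod_dvd.
Qed.

Lemma is_padic_square_approx (p : nat) (d : int) (k : nat) :
  is_padic_square p d -> exists y, (p%:Z ^+ k %| y ^+ 2 - d)%Z.
Proof.
case=> x /(congr1 (fun z => padic_res z k)) /= e; exists (padic_res x k).
by rewrite -eqz_mod_dvd expr2 e.
Qed.

(** The same linear congruence as in [nroots_hensel], solved over one given root. *)
Lemma hensel_lift (u v : int) (p k : nat) (x : int) : prime p ->
  ~~ (p%:Z %| u ^+ 2 - 4 * v)%Z -> (0 < k)%N -> (p%:Z ^+ k %| quad u v x)%Z ->
  exists y, (p%:Z ^+ k %| y - x)%Z /\ (p%:Z ^+ k.+1 %| quad u v y)%Z.
Proof.
move=> pp npd k0 /dvdzP[r Er].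
have pdvd : (p%:Z %| p%:Z ^+ k)%Z by case: k k0 {Er} => // k _; rewrite exprS dvdz_mulr.
have npb : ~~ (p%:Z %| 2 * x + u)%Z.
  by apply: quad_deriv_unit npd _; rewrite Er dvdz_mull.
have [t ht|no_t] := pickP (fun t : 'I_p => (p%:Z %| (r + (2 * x + u) * t%:Z)%R)%Z).
  exists (x + p%:Z ^+ k * t%:Z); split; first by rewrite addrC addKr dvdz_mulr.
  have -> : quad u v (x + p%:Z ^+ k * t%:Z) =
      p%:Z ^+ k * (r + (2 * x + u) * t%:Z + p%:Z ^+ k * t%:Z ^+ 2).
    have -> : quad u v (x + p%:Z ^+ k * t%:Z) = quad u v x +
        p%:Z ^+ k * ((2 * x + u) * t%:Z + p%:Z ^+ k * t%:Z ^+ 2).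
      by rewrite /quad; ring.
    by rewrite Er; ring.
  by rewrite [p%:Z ^+ k.+1]exprSr dvdz_mul // rpredD // dvdz_mulr.
by have := count_linear_root r pp npb; rewrite big1 // => t _; rewrite no_t.
Qed.

Lemma hensel_sequence (u v : int) (p : nat) (x : int) : prime p ->
  ~~ (p%:Z %| u ^+ 2 - 4 * v)%Z -> (p%:Z %| quad u v x)%Z ->
  exists z : nat -> int, forall k,
    (p%:Z ^+ k %| z k.+1 - z k)%Z /\ (p%:Z ^+ k %| quad u v (z k))%Z.
Proof.
move=> pp npd px.
have /boolp.choice[step hstep] : forall kx : nat * int, exists y,
    (p%:Z ^+ kx.1.+1 %| quad u v kx.2)%Z ->
    (p%:Z ^+ kx.1.+1 %| y - kx.2)%Z /\ (p%:Z ^+ kx.1.+2 %| quad u v y)%Z.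
  move=> [k y] /=; case: (boolP (p%:Z ^+ k.+1 %| quad u v y)%Z) => h.
    by have [w hw] := hensel_lift pp npd (ltn0Sn k) h; exists w.
  by exists 0.
pose z := fix z k := if k is k'.+1 then step (k', z k') else x.
have hz k : (p%:Z ^+ k.+1 %| quad u v (z k))%Z.
  elim: k => [|k IH]; first by rewrite expr1.
  by have [] := hstep (k, z k) IH.
have weaken k a : (p%:Z ^+ k.+1 %| a)%Z -> (p%:Z ^+ k %| a)%Z.
  by apply: dvdz_trans; rewrite exprS dvdz_mull.
by exists z => k; split; apply: weaken => //; have [] := hstep (k, z k) (hz k).
Qed.

Lemma Posz_exp (p k : nat) : (p ^ k)%N%:Z = p%:Z ^+ k.
Proof. by rewrite -[LHS]natz natrX natz. Qed.
Lemma nroots_p2e (p e j : nat) (D : int) : prime p ->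
  nroots 0 (- (p%:Z ^+ (2 * e) * D)) (p ^ (2 * e + j)) =
  (p ^ e * nroots 0 (- D) (p ^ j))%N.
Proof.
move=> pp; elim: e => [|e IH]; first by rewrite muln0 mul1r mul1n.
rewrite (_ : (2 * e.+1 + j)%N = (2 * e + j).+2); last lia.
by rewrite mulnS exprD -mulrA nroots_p2D // IH expnS mulnA.
Qed.

Lemma nroots_gt0 (u v y : int) (m : nat) : (0 < m)%N ->
  (m%:Z %| quad u v y)%Z -> (0 < nroots u v m)%N.
Proof.
move=> m0 h; rewrite /nroots (bigD1 (Ordinal (ltn_modz y m0))) //=.
rewrite gez0_abs; last by apply: modz_ge0; rewrite eqz_nat -lt0n.
have -> : (m%:Z %| quad u v (y %% m%:Z)%Z)%Z by
  rewrite (@dvdz_quad_congr u v m%:Z _ y) // -eqz_mod_dvd; apply/eqP; exact: modz_mod.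
by [].
Qed.

(** An approximation of the square root modulo p^(2e+j) is a root for p^(2e) D; the
roots for p^(2e) D modulo p^(2e+j) are p^e times as many as those for D modulo
p^j. *)
Lemma padic_square_nroots (p j e : nat) (D : int) : prime p ->
  is_padic_square p (p%:Z ^+ (2 * e) * D) -> (0 < nroots 0 (- D) (p ^ j))%N.
Proof.
move=> pp /(@is_padic_square_approx _ _ (2 * e + j)) [y hy].
have : (0 < nroots 0 (- (p%:Z ^+ (2 * e) * D)) (p ^ (2 * e + j)))%N.
  apply: (@nroots_gt0 _ _ y); first by rewrite expn_gt0 prime_gt0.
  by rewrite /quad mul0r addr0 Posz_exp.
by rewrite nroots_p2e // muln_gt0 => /andP[].
Qed.

(** * Class numbers at primes dividing the discriminant *)

Lemma discriminantP (d : int) : is_discriminant d ->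
  exists u v, (u = 0 \/ u = 1) /\ d = u ^+ 2 - 4 * v.
Proof.
case=> /eqP; rewrite eqz_mod_dvd => /dvdzP[q Eq].
  by exists 0, (- q); split; [left|lia].
by exists 1, (- q); split; [right|lia].
Qed.

Lemma is_discriminant_quad (u v : int) : u = 0 \/ u = 1 ->
  is_discriminant (u ^+ 2 - 4 * v).
Proof.
case=> ->; [left|right]; apply/eqP; rewrite eqz_mod_dvd; apply/dvdzP; exists (- v); ring.
Qed.

Section Counts.
Variables (R : realType) (S : int -> set bqf).
Hypothesis hS : forall e : int, is_discriminant e -> is_representatives e (S e).

Lemma C_nclasses (u v m : int) : u = 0 \/ u = 1 -> m != 0 ->
  C R S (u ^+ 2 - 4 * v) m = (nclasses u v `|m|)%:R%:E.
Proof. by move=> hu m0; apply: class_count => //; exact/hS/is_discriminant_quad. Qed.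

Lemma C_ppow (u v : int) (p n : nat) : u = 0 \/ u = 1 -> prime p ->
  C R S (u ^+ 2 - 4 * v) (p%:Z ^+ n) = (class_sum u v p n)%:R%:E.
Proof.
move=> hu pp; rewrite -Posz_exp C_nclasses // ?nclasses_ppow //.
by rewrite eqz_nat -lt0n expn_gt0 prime_gt0.
Qed.

Lemma C_odd_ppow (d : int) (p n : nat) : is_discriminant d -> prime p -> odd p ->
  C R S d (p%:Z ^+ n) = (class_sum 0 (- d) p n)%:R%:E.
Proof.
move=> /discriminantP[u [v [hu ->]]] pp op.
by rewrite C_ppow // class_sum_odd // opprB.
Qed.

Lemma C_two_ppow (D : int) (n : nat) :
  C R S (4 * D) (2 ^+ n) = (class_sum 0 (- D) 2 n)%:R%:E.
Proof.
have -> : 4 * D = 0 ^+ 2 - 4 * (- D) by ring.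
by rewrite -[2 : int]/(2%N%:Z) C_ppow //; left.
Qed.

Lemma C_zero_ppow (p n : nat) : prime p ->
  C R S 0 (p%:Z ^+ n) = (geom_sum p n./2.+1)%:R%:E.
Proof.
by move=> pp; rewrite -class_sum_zero // oppr0 -C_ppow //; left.
Qed.
End Counts.

Lemma geom_sumSr (p k : nat) : geom_sum p k.+1 = (geom_sum p k + p ^ k)%N.
Proof. by rewrite /geom_sum big_ord_recr. Qed.

Lemma geom_sumE (R : realType) (p k : nat) : (1 < p)%N ->
  (geom_sum p k)%:R = (p%:R ^+ k - 1) / (p%:R - 1) :> R.
Proof.
move=> p1; have pr : p%:R - 1 != 0 :> R by rewrite subr_eq0 pnatr_eq1; lia.
elim: k => [|k IH]; first by rewrite /geom_sum big_ord0 expr0 subrr mul0r.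
by rewrite geom_sumSr natrD IH natrX exprS; field.
Qed.

Lemma geom_sum2 (k : nat) : (geom_sum 2 k + 1 = 2 ^ k)%N.
Proof.
elim: k => [|k IH]; first by rewrite /geom_sum big_ord0.
by rewrite geom_sumSr expnS; lia.
Qed.

Lemma natr_eq_sub1 (R : realType) (a b : nat) : (a + 1 = b)%N ->
  a%:R = b%:R - 1 :> R.
Proof. by move<-; rewrite natrD addrK. Qed.

Lemma class_sum_2_5mod8 (n : nat) (v : int) : ~~ (2 %| v)%Z -> (0 < n)%N ->
  class_sum 0 (- (1 - 4 * v)) 2 n = if odd n then 1%N else 3%N.
Proof.
case: n => [|[|n]] // nv _; first by rewrite class_sum1 nroots_two.
rewrite class_sum_2_1mod4 class_sum_unit //; last lia.
by rewrite nroots_1_two (negPf nv) mul0n addn0 /= negbK; case: (odd n).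
Qed.

Lemma class_sum_2_1mod8_odd (k : nat) (v : int) : (2 %| v)%Z ->
  class_sum 0 (- (1 - 4 * v)) 2 (2 * k + 1) = (4 * k + 1)%N.
Proof.
case: k => [|k] hv; first by rewrite class_sum1 nroots_two.
rewrite (_ : (2 * k.+1 + 1)%N = (2 * k + 1).+2); last lia.
rewrite class_sum_2_1mod4 class_sum_unit //; last lia.
by rewrite nroots_1_two hv; lia.
Qed.

Lemma class_sum_2_1mod8_even (k : nat) (v : int) : (2 %| v)%Z ->
  class_sum 0 (- (1 - 4 * v)) 2 (2 * k + 2) = (4 * k + 3)%N.
Proof.
move=> hv; rewrite addn2 class_sum_2_1mod4 class_sum_unit //; last lia.
by rewrite nroots_1_two hv; lia.
Qed.

Lemma odd_prime_ndvd_disc (p : nat) (D : int) : prime p -> odd p ->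
  ~~ (p%:Z %| D)%Z -> ~~ (p%:Z %| 0 ^+ 2 - 4 * - D)%Z.
Proof.
move=> pp op npD; have -> : 0 ^+ 2 - 4 * - D = 2 * (2 * D) by ring.
rewrite !dvdz_prime_mul // (negPf npD) orbF orbb dvdzE /= dvdn_prime2 //.
by apply: contraL op => /eqP->.
Qed.

(** If delta is odd, the congruence for p^delta D has no solution modulo
p^(delta+1); if it is even, D itself must be a square modulo p, and Hensel lifting
of such a root gives the converse. *)
Lemma padic_square_odd (p delta : nat) (D : int) : prime p -> odd p ->
  ~~ (p%:Z %| D)%Z ->
  is_padic_square p (p%:Z ^+ delta * D) <-> ~~ odd delta /\ nroots 0 (- D) p = 2%N.
Proof.
move=> pp op npD; split => [hsq|[ed hr]].
  have Ed := odd_double_half delta; rewrite -mul2n in Ed.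
  case od : (odd delta) Ed => /= Ed.
    have := hsq; rewrite -Ed addnC exprD expr1 -mulrA.
    by move=> /(padic_square_nroots 2 pp); rewrite nroots_pD.
  split=> //; have := hsq; rewrite -Ed add0n => /(padic_square_nroots 1 pp).
  rewrite expn1; have [[x hx] _|nx] := pselect (exists x : int, (p%:Z %| x ^+ 2 - D)%Z).
    exact: nroots_prime_square hx.
  by rewrite nroots_prime_nonsquare // => x; apply/negP => hx; apply: nx; exists x.
have [x hx] : exists x, (p%:Z %| quad 0 (- D) x)%Z.
  apply: contrapT => nx; move: hr; rewrite nroots_prime_nonsquare // => x.
  apply/negP => hx; apply: nx; exists x.
  by rewrite /quad mul0r addr0.
have npd := odd_prime_ndvd_disc pp op npD.
have [z hz] := hensel_sequence pp npd hx.
have -> : delta = (2 * delta./2)%N by rewrite mul2n even_halfK.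
apply: (@is_padic_square_lim _ _ (fun k => p%:Z ^+ delta./2 * z k)) => k.
  by rewrite -mulrBr dvdz_mull // (hz k).1.
have -> : (p%:Z ^+ delta./2 * z k) ^+ 2 - p%:Z ^+ (2 * delta./2) * D =
    p%:Z ^+ (2 * delta./2) * quad 0 (- D) (z k).
  by rewrite /quad mulnC exprM; ring.
by rewrite dvdz_mull // (hz k).2.
Qed.

(** Solvability modulo 2^(2e+3) forces D to be a square modulo 8.  Conversely, for
D = 1 - 8w the simple root 0 of y^2 + y + 2w modulo 2 lifts to a sequence z, and
2^e (2 z + 1) is the square root. *)
Lemma padic_square_two (e : nat) (D : int) : (D = 1 %[mod 2])%Z ->
  is_padic_square 2 (2 ^+ (2 * e) * D) <-> (D = 1 %[mod 8])%Z.
Proof.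
move=> oD; split => [hsq|D1].
  have := @padic_square_nroots 2 3 e D isT hsq.
  have [v [->|->]] : exists v, D = 1 - 4 * v \/ D = 3 + 4 * v.
    have [h|h] : (D = 1 %[mod 4])%Z \/ (D = 3 %[mod 4])%Z by lia.
      by exists (- (D %/ 4)%Z); left; lia.
    by exists (D %/ 4)%Z; right; lia.
    rewrite nroots_1mod4 nroots_1_two; case: ifP => //; lia.
  by rewrite nroots_3mod4.
have [w Ew] : exists w, D = 1 - 4 * (2 * w) by exists (- (D %/ 8)%Z); lia.
have [//||z hz] := @hensel_sequence 1 (2 * w) 2 0 isT _ _.
- lia.
- by rewrite /quad; lia.
apply: (@is_padic_square_lim _ _ (fun k => 2%:Z ^+ e * (2 * z k + 1))) => k.
  have -> : 2%:Z ^+ e * (2 * z k.+1 + 1) - 2%:Z ^+ e * (2 * z k + 1) =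
     2%:Z ^+ e * 2 * (z k.+1 - z k) by ring.
  by rewrite dvdz_mull // (hz k).1.
have -> : (2%:Z ^+ e * (2 * z k + 1)) ^+ 2 - 2 ^+ (2 * e) * D =
    2 ^+ (2 * e) * 4 * quad 1 (2 * w) (z k).
  by rewrite Ew /quad mulnC exprM; ring.
by rewrite dvdz_mull // (hz k).2.
Qed.

(** With delta = 2e or 2e + 1, the first e steps of the recurrence contribute the
geometric sum 1 + ... + p^(e-1), and the last one is p^e times the class number
for the unit D or for pD. *)
Lemma class_sum_odd_disc (p delta n : nat) (D : int) : prime p -> odd p ->
  ~~ (p%:Z %| D)%Z -> (0 < delta < n)%N ->
  let k := uphalf (n - delta) in
  class_sum 0 (- (p%:Z ^+ delta * D)) p n =
  (geom_sum p (n - 2 * k)./2.+1 +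
   if ~~ odd delta && (nroots 0 (- D) p == 2) then 2 * k * p ^ delta./2 else 0)%N.
Proof.
move=> pp op npD /andP[d0 dn] k.
have Ed := odd_double_half delta; rewrite -mul2n in Ed.
set e := delta./2 in Ed *.
case od : (odd delta) Ed => /= Ed.
  have [j Ej] : exists j, n = (2 * e + j)%N by exists (n - 2 * e)%N; lia.
  rewrite -Ed addnC exprD expr1 -mulrA {1}Ej class_sum_p2e // class_sum_pD // muln1.
  rewrite addn0 -geom_sumSr; congr geom_sum; rewrite /k; lia.
have [j Ej] : exists j, n = (2 * e + j)%N by exists (n - 2 * e)%N; lia.
have ke : k = uphalf j by rewrite /k; lia.
rewrite -Ed add0n {1}Ej class_sum_p2e // class_sum_unit ?odd_prime_ndvd_disc //.
have Eg : geom_sum p (n - 2 * k)./2.+1 = (geom_sum p e + p ^ e * ~~ odd j)%N.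
  case oj : (odd j).
    by rewrite muln0 addn0; congr geom_sum; lia.
  by rewrite muln1 -geom_sumSr; congr geom_sum; lia.
rewrite Eg ke mulnDr addnA; congr addn.
have [[x hx]|nx] := pselect (exists x : int, (p%:Z %| x ^+ 2 - D)%Z).
  by rewrite (nroots_prime_square pp op npD hx) eqxx mulnC.
rewrite nroots_prime_nonsquare ?mul0n ?muln0 // => x.
by apply/negP => hx; apply: nx; exists x.
Qed.

Theorem mainTheorem1 (R : realType) (S : int -> set bqf)
    (hS : forall e : int, is_discriminant e -> is_representatives e (S e))
    (d : int) (hd : is_discriminant d) :
  (* (I) *)
  ((forall m : int, m != 0 -> coprimez m d -> C R S d m = ((K d m)%:~R)%:E) /\
   C R S d 1 = 1%:E /\ C R S d (-1) = 1%:E) /\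
  (* (II) *)
  (forall p : nat, prime p -> (p%:Z %| d)%Z ->
   let B := fun (e : int) (n : nat) => C R S e (p%:Z ^+ n) in
   B d 0%N = 1%:E /\ B d 1%N = 1%:E /\
   (* (a) *)
   (forall n : nat, (2 <= n)%N ->
      B 0 n = ((p%:R ^+ (n./2).+1 - 1) / (p%:R - 1))%:E) /\
   (* (b); here uphalf is the ceiling of the half, and delta is even
      as soon as d is a p-adic square *)
   (odd p -> d != 0 ->
    forall (delta : nat) (D : int), (0 < delta)%N -> coprimez D p%:Z ->
    d = p%:Z ^+ delta * D ->
    forall n : nat, (2 <= n)%N ->
      ((n <= delta)%N -> B d n = B 0 n) /\
      ((delta < n)%N ->
       let k := uphalf (n - delta) in
       (is_padic_square p d ->
          B d n = (B 0%R (n - 2 * k)%N + ((2 * k * p ^ (delta./2))%N%:R)%:E)%E) /\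
       (~ is_padic_square p d -> B d n = B 0 (n - 2 * k)%N))) /\
   (* (c) *)
   (p = 2%N ->
    forall delta : nat, (0 < delta)%N ->
    (* (c1) *)
    (forall D : int, (D = 1 %[mod 2])%Z -> d = 2 ^+ (2 * delta + 1) * D ->
       forall n : nat, (2 <= n)%N ->
         ((n <= 2 * delta - 1)%N -> B d n = B 0 n) /\
         ((2 * delta <= n)%N -> B d n = (2 ^+ delta - 1)%:E)) /\
    (* (c2) *)
    (forall D : int, (D = 3 %[mod 4])%Z -> d = 2 ^+ (2 * delta) * D ->
       forall n : nat, (2 <= n)%N ->
         ((n <= 2 * delta - 2)%N -> B d n = B 0 n) /\
         ((2 * delta - 2 <= n)%N -> B d n = (2 ^+ delta - 1)%:E)) /\
    (* (c3) *)
    (forall D : int, (D = 5 %[mod 8])%Z -> d = 2 ^+ (2 * delta) * D ->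
       forall n : nat, (2 <= n)%N ->
         ((n <= 2 * delta - 2)%N -> B d n = B 0 n) /\
         ((2 * delta - 1 <= n)%N ->
            (odd n -> B d n = (2 ^+ delta - 1)%:E) /\
            (~~ odd n -> B d n = (2 ^+ (delta + 1) - 1)%:E))) /\
    (* (c4) *)
    (forall D : int, (D = 1 %[mod 2])%Z -> d = 2 ^+ (2 * delta) * D ->
       ((D = 1 %[mod 8])%Z <-> is_padic_square 2 d) /\
       ((D = 1 %[mod 8])%Z ->
          (forall n : nat, (2 <= n)%N -> (n <= 2 * delta - 2)%N ->
             B d n = B 0 n) /\
          (forall k : nat,
             B d (2 * delta - 1 + 2 * k)%N =
               (2 ^+ delta * (2 * k%:R + 1) - 1)%:E /\
             B d (2 * delta + 2 * k)%N =
               (2 ^+ (delta + 1) * (k%:R + 1) - 1)%:E))))).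
Proof.
split.
  have CK (m : int) : m != 0 -> coprimez m d -> C R S d m = ((K d m)%:~R)%:E.
    move=> m0; have [u [v [hu ->]]] := discriminantP hd => cmd.
    rewrite C_nclasses // /K -nclasses_kronecker ?absz_gt0 //.
  have C1 (m : int) : `|m|%N = 1%N -> C R S d m = 1%:E.
    move=> m1; rewrite CK; last by rewrite /coprimez /gcdz m1 gcd1n.
      by rewrite /K m1 -[divisors _]/[:: 1%N] big_seq1 kronecker1.
    by rewrite -absz_eq0 m1.
  by split=> //; split; apply: C1.
move=> p pp pd B.
have p1 := prime_gt1 pp.
have B0E n : B 0 n = (geom_sum p n./2.+1)%:R%:E by exact: C_zero_ppow.
(* Completing the square: D is d for p odd and d / 4 for p = 2. *)
have BE : exists D, (forall n, B d n = (class_sum 0 (- D) p n)%:R%:E) /\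
    nroots 0 (- D) p = 1%N.
  have [p2|op] := even_prime pp.
    have [D ED] : exists D, d = 4 * D.
      exists (d %/ 4)%Z; move: hd pd; rewrite /is_discriminant p2; lia.
    exists D; split=> [n|]; last by rewrite p2 nroots_two.
    by rewrite /B p2 ED C_two_ppow.
  by exists d; split=> [n|]; [exact: C_odd_ppow|exact: nroots_p_dvd].
split; first by case: BE => D [-> _]; rewrite class_sum0.
split; first by case: BE => D [-> h]; rewrite class_sum1 h.
split; first by move=> n _; rewrite B0E geom_sumE.
split.
  move=> op d0 delta D delta0 cDp Ed n n2; clear BE.
  have npD : ~~ (p%:Z %| D)%Z.
    by rewrite dvdzE /= -prime_coprime // coprime_sym.
  have BE j : B d j = (class_sum 0 (- d) p j)%:R%:E by exact: C_odd_ppow.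
  split=> [nd|dn k].
    rewrite BE B0E -class_sum_zero // class_sum_dvd //.
    by rewrite Ed dvdz_mulr // dvdz_exp2l.
  rewrite BE B0E Ed class_sum_odd_disc ?delta0 //; split=> [|nsq].
    move=> /(padic_square_odd _ pp op npD)[-> ->]; rewrite eqxx /=.
    by rewrite natrD EFinD.
  case: ifP => [/andP[ed /eqP hr]|_]; last by rewrite addn0.
  by exfalso; apply: nsq; apply/padic_square_odd.
(* From here on p = 2 and delta = e + 1, so that d / 4 = 2 ^+ (2 * e) * D. *)
move=> p2 [//|e] _; subst p; clear BE.
have B4 D n : d = 4 * D -> B d n = (class_sum 0 (- D) 2 n)%:R%:E.
  by rewrite /B => ->; exact: C_two_ppow.
(* If 2 ^ n divides d / 4, the congruences modulo 2 ^ j with j <= n are those for 0. *)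
have small D D' n : d = 4 * D -> D = 2%:Z ^+ n * D' -> B d n = B 0 n.
  move=> ED ED'; rewrite (B4 _ _ ED) B0E -class_sum_zero // class_sum_dvd //.
  by rewrite ED' dvdz_mulr.
have small' D D' n j : d = 4 * D -> D = 2%:Z ^+ j * D' -> (n <= j)%N -> B d n = B 0 n.
  move=> ED ED' nj; apply: (small _ (2%:Z ^+ (j - n) * D') _ ED).
  by rewrite ED' mulrA -exprD subnKC.
have dE D : d = 2 ^+ (2 * e.+1) * D -> d = 4 * (2%:Z ^+ (2 * e) * D).
  by rewrite mulnS exprD => ->; ring.
have BEe D j : d = 2 ^+ (2 * e.+1) * D ->
    B d (2 * e + j)%N = (geom_sum 2 e + 2 ^ e * class_sum 0 (- D) 2 j)%N%:R%:E.
  by move=> /dE/B4 ->; rewrite class_sum_p2e.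
have g2 := geom_sum2 e.
have fin (a b : nat) : (a + 1 = b)%N -> a%:R%:E = (b%:R - 1)%:E :> \bar R.
  by move=> /(natr_eq_sub1 R) ->.
split; [|split; [|split]].
- move=> D D1 Ed n n2.
  have Ed' : d = 2 ^+ (2 * e.+1) * (2 * D).
    by rewrite Ed exprD expr1 mulrA.
  split=> hn.
    apply: (small' _ D n (2 * e + 1)%N (dE _ Ed')); last lia.
    by rewrite exprD expr1 mulrA.
  have -> : n = (2 * e + (n - 2 * e))%N by lia.
  rewrite (BEe _ _ Ed') class_sum_pD //; last lia.
  by rewrite -natrX; apply: fin; rewrite expnS; lia.
- move=> D D3 Ed n n2; split=> hn.
    by apply: (small' _ D n (2 * e)%N (dE _ Ed)); last lia.
  have -> : n = (2 * e + (n - 2 * e))%N by lia.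
  have [w Ew] : exists w, D = 3 + 4 * w by exists (D %/ 4)%Z; lia.
  rewrite (BEe _ _ Ed) Ew class_sum_2_3mod4.
  by rewrite -natrX; apply: fin; rewrite expnS; lia.
- move=> D D5 Ed n n2; split=> hn.
    by apply: (small' _ D n (2 * e)%N (dE _ Ed)); last lia.
  have En : n = (2 * e + (n - 2 * e))%N by lia.
  have [w [Ew ow]] : exists w, D = 1 - 4 * w /\ ~~ (2 %| w)%Z.
    by exists (- (D %/ 4)%Z); lia.
  rewrite En (BEe _ _ Ed) Ew class_sum_2_5mod8 //; last lia.
  have -> : odd (2 * e + (n - 2 * e)) = odd (n - 2 * e) by rewrite oddD oddM.
  split=> [->|/negPf->]; rewrite -natrX; apply: fin; rewrite ?addn1 !expnS; lia.
move=> D D1 Ed; split.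
  by rewrite Ed; split=> /(padic_square_two _ D1).
move=> D1'; split=> [n n2 hn|k].
  by apply: (small' _ D n (2 * e)%N (dE _ Ed)); last lia.
have [w [Ew ew]] : exists w, D = 1 - 4 * w /\ (2 %| w)%Z.
  by exists (- (D %/ 4)%Z); lia.
rewrite Ew in Ed.
have -> : (2 * e.+1 - 1 + 2 * k = 2 * e + (2 * k + 1))%N by lia.
have -> : (2 * e.+1 + 2 * k = 2 * e + (2 * k + 2))%N by lia.
rewrite !(BEe _ _ Ed) class_sum_2_1mod8_odd // class_sum_2_1mod8_even //.
have -> : 2 ^+ e.+1 * (2 * k%:R + 1) = (2 ^ e.+1 * (2 * k + 1))%N%:R :> R.
  by rewrite natrM natrX natrD natrM.
have -> : 2 ^+ (e.+1 + 1) * (k%:R + 1) = (2 ^ (e.+1 + 1) * (k + 1))%N%:R :> R.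
  by rewrite natrM natrX natrD.
by split; apply: fin; rewrite ?addn1 !expnS; nia.
Qed.
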